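(* For each $n\ge1$ let $\mathcal{C}_3(\mathbb{T}^n)$ be the collection of (almost everywhere defined) functions on $\mathbb{T}^n$ of the form $$(z_1,\dots,z_n)\mapsto\max\{\log|P_1(z_1,\dots,z_n)|,\dots,\log|P_k(z_1,\dots,z_n)|\},$$ and let $\mathcal{C}_4(\mathbb{T}^n)$ be the collection of (almost everywhere defined) functions on $\mathbb{T}^n$ of the form $$(z_1,\dots,z_n)\mapsto\log|P_1(z_1,\dots,z_n)|\cdot\log|P_2(z_1,\dots,z_n)|\cdots\log|P_k(z_1,\dots,z_n)|,$$ where in both cases $k\ge1$ and each $P_i$ is a nonzero Laurent polynomial in $\mathbb{C}[Z_1^{\pm1},\dots,Z_n^{\pm1}]$. Then $\mathcal{C}_3=\bigcup_{n\ge1}\mathcal{C}_3(\mathbb{T}^n)$ and $\mathcal{C}_4=\bigcup_{n\ge1}\mathcal{C}_4(\mathbb{T}^n)$ are Boyd--Lawton collections.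
   Context: $\mathbb{T}$ is the unit circle in $\mathbb{C}$; $\mathbb{T}^n=\{(z_1,\dots,z_n)\in\mathbb{C}^n: |z_1|=\dots=|z_n|=1\}$ is a compact group under coordinatewise multiplication, with normalized Haar measure $\tau_n$ (total mass 1); $\tau=\tau_1$. For an $n\times m$ integer matrix $A=(a_{ij})$, $q_A\colon\mathbb{T}^m\to\mathbb{T}^n$ is the continuous homomorphism $q_A(z_1,\dots,z_m)=(z_1^{a_{11}}z_2^{a_{12}}\cdots z_m^{a_{1m}},\dots,z_1^{a_{n1}}z_2^{a_{n2}}\cdots z_m^{a_{nm}})$. A vector $\mathbf{r}\in\mathbb{Z}^n$ is viewed as an $n\times1$ matrix, so $q_{\mathbf{r}}\colon\mathbb{T}\to\mathbb{T}^n$, $q_{\mathbf r}(z)=(z^{r_1},\dots,z^{r_n})$. The Boyd height is $\mu(q_A)=\mu(A)=\min\{\|\mathbf{v}\|_\infty:\mathbf{v}\in\mathbb{Z}^n,\ \mathbf{v}\ne\mathbf{0},\ \mathbf{v}\cdot A=\mathbf{0}\}$ ($\mathbf v$ a row vector), and $\mu(q_A)=\infty$ if no such $\mathbf{v}$ exists. A Boyd--Lawton collection $\mathcal{C}=\bigcup_{n\ge1}\mathcal{C}(\mathbb{T}^n)$ is a collection of functions such that: (1) If $g\in\mathcal{C}(\mathbb{T}^n)$ then $g$ is defined and complex-valued almost everywhere on $\mathbb{T}^n$ and is integrable (it gives an element of $L^1(\mathbb{T}^n)$). (2) For each $g\in\mathcal{C}(\mathbb{T}^n)$ with $n\ge2$,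 $\int_{\mathbb{T}^n}g\,d\tau_n=\lim_{\mu(q_{\mathbf r})\to\infty}\int_{\mathbb{T}}g\circ q_{\mathbf r}\,d\tau$, where $q_{\mathbf r}\colon\mathbb{T}\to\mathbb{T}^n$ varies over the homomorphisms given by $\mathbf r\in\mathbb{Z}^n$ (implicit: for all large enough $\mu(q_{\mathbf r})$ the function $g\circ q_{\mathbf r}$ is integrable). The limit means: for every $\varepsilon>0$ there is $M$ such that the two integrals differ by less than $\varepsilon$ whenever $\mu(q_{\mathbf r})\ge M$. (3) If $g\in\mathcal{C}(\mathbb{T}^n)$, there is a bound $B$ such that for every $m\ge1$ and every $q_A\colon\mathbb{T}^m\to\mathbb{T}^n$ with $\mu(q_A)\ge B$, the composition $g\circ q_A$ is in $\mathcal{C}(\mathbb{T}^m)$. Functions are actual (partially defined) functions: with the convention $\log 0=-\infty$, the maximum is defined where not all $P_i$ vanish, and the product is defined where no $P_i$ vanishes; $g\circ q_A$ is defined at the points that $q_A$ maps into the domain of $g$. *)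

(* Defs.v *)
From HB Require Import structures.
From mathcomp Require Import all_boot all_order all_algebra.
From mathcomp Require Import finmap complex.
From mathcomp Require Import all_classical all_reals all_analysis.
From mathcomp Require Import measurable_realfun ring lra.

Set Implicit Arguments.
Unset Strict Implicit.
Unset Printing Implicit Defensive.

Import Order.TTheory GRing.Theory Num.Theory.
Import numFieldNormedType.Exports.
Import ComplexField.Normc.

Local Open Scope classical_set_scope.
Local Open Scope ring_scope.
Local Open Scope complex_scope.

Record circle (R : realType) := Circle {
  circle_val :> R[i];
  circleP : `|circle_val| == 1
}.

HB.instance Definition _ (R : realType) := [isSub for @circle_val R].
HB.instance Definition _ (R : realType) := [Choice of circle R by <:].

Section circle_structure.
Context {R : realType}.

Let circle1_subproof : `|1 : R[i]| == 1. Proof. by rewrite normr1. Qed.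

Definition circle1 : circle R := Circle circle1_subproof.

HB.instance Definition _ := isPointed.Build (circle R) circle1.

Let circle_mul_subproof (z w : circle R) :
  `|(z : R[i]) * (w : R[i])| == 1.
Proof. by rewrite normrM (eqP (circleP z)) (eqP (circleP w)) mulr1. Qed.

Definition circle_mul (z w : circle R) : circle R :=
  Circle (circle_mul_subproof z w).

Definition circle_coord (z : circle R) :=
  (complex.Re z : measurableTypeR R, complex.Im z : measurableTypeR R).

(* The Borel sigma-algebra of the circle: traces on the circle of the Borel sets
   of R * R. The library's sigma-algebra on n.-tuple (circle R) is the product
   one, i.e. the Borel sigma-algebra of the torus. *)
HB.instance Definition _ := Measurable.copy (circle R)
  (g_sigma_algebra_preimageType circle_coord).

Lemma measurable_circle_coord : measurable_fun setT circle_coord.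
Proof. by move=> _ B mB; exists B. Qed.

Lemma measurable_to_circle d (T : measurableType d) (f : T -> circle R) :
  measurable_fun setT (fun x => complex.Re (f x)) ->
  measurable_fun setT (fun x => complex.Im (f x)) ->
  measurable_fun setT f.
Proof.
move=> mre mim _ _ [B mB <-].
have mc : measurable_fun setT (circle_coord \o f).
  by apply/measurable_fun_pairP; split.
by have := mc measurableT B mB; rewrite !setTI.
Qed.

Let circle_exp_subproof (t : R) :
  `|(cos (2 * pi * t) +i* sin (2 * pi * t))| == 1 :> R[i].
Proof. by rewrite normc_def /= cos2Dsin2 sqrtr1. Qed.

Definition circle_exp (t : measurableTypeR R) : circle R :=
  Circle (circle_exp_subproof t).

Lemma measurable_circle_exp : measurable_fun setT circle_exp.
Proof.
have mt : measurable_fun setT (fun t : measurableTypeR R => 2 * pi * t).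
  by apply: measurable_funM.
have mcos := continuous_measurable_fun (@continuous_cos R).
have msin := continuous_measurable_fun (@continuous_sin R).
apply: measurable_to_circle => /=.
- exact: (measurableT_comp mcos mt).
- exact: (measurableT_comp msin mt).
Qed.

HB.instance Definition _ :=
  isMeasurableFun.Build _ _ _ _ circle_exp measurable_circle_exp.

End circle_structure.

Notation torus R n := (n.-tuple (circle R)).

Section haar.
Context {R : realType}.

(* Normalized arc length: the law of exp(2 i pi t) for t uniform on [0, 1].
   [haar_translation] below shows that [haar n] is translation invariant, so
   that it is the Haar probability measure of the torus. *)
Definition circle_haar : probability (circle R) R :=
  distribution (uniform_prob (@ltr01 R)) (@circle_exp R).

Definition torus_cons n (x : circle R * torus R n) : torus R n.+1 :=
  [tuple of x.1 :: x.2].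

Lemma measurable_torus_cons n : measurable_fun setT (@torus_cons n).
Proof. exact: measurable_cons. Qed.

HB.instance Definition _ n :=
  isMeasurableFun.Build _ _ _ _ (@torus_cons n) (@measurable_torus_cons n).

Fixpoint haar n : probability (torus R n) R :=
  if n is m.+1 then distribution (circle_haar \x haar m)%E (@torus_cons m)
  else dirac [tuple].

End haar.

Section haar_invariance.
Context {R : realType}.
Local Notation mu := (@lebesgue_measure R).
Local Notation RR := (measurableTypeR R).

Let mtrans (s : R) : measurable_fun setT ((fun t => t + s) : RR -> RR).
Proof. exact: measurable_funD. Qed.

Let lebesgue_translation (s : R) (A : set RR) : measurable A ->
  mu ((fun t : RR => t + s) @^-1` A) = mu A.
Proof.
pose f : RR -> RR := fun t => t + s.
have mf : measurable_fun setT f := mtrans s.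
pose mfx := isMeasurableFun.Build _ _ _ _ f mf.
pose F : {mfun RR >-> RR} := HB.pack f mfx.
move=> mA; apply/esym.
apply: (@lebesgue_measure_unique R (pushforward mu F)) => // _ [[a b]] /= _ <-.
rewrite /pushforward /=.
have -> : F @^-1` `]a, b]%classic = `]a - s, b - s]%classic.
  by apply/seteqP; split=> x /=; rewrite !in_itv /= /f ltrBlDr lerBrDr.
rewrite !lebesgue_measure_itv /= !lte_fin ltrD2r.
by case: ifP => // _; rewrite -!EFinB; congr (_%:E); rewrite opprB addrA subrK.
Qed.

Let uniform01 (A : set RR) : measurable A ->
  uniform_prob (@ltr01 R) A = mu (A `&` `[0, 1[%classic).
Proof.
move=> mA; rewrite /uniform_prob integral_uniform_pdf.
rewrite (eq_integral (fun=> 1%E)); last first.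
  by move=> x /[!inE] -[_] /=; rewrite in_itv /= /uniform_pdf => ->; rewrite subr0 invr1.
rewrite integral_cst ?mul1e; last exact: measurableI.
have -> : `[0, 1]%classic = `[(0:R), 1[%classic `|` [set 1].
  by rewrite setUitv1 //= bnd_simp.
rewrite setIUr measureU0 //; try exact: measurableI.
apply/eqP; rewrite eq_le measure_ge0 andbT -(lebesgue_measure_set1 (1 : R)).
by apply: le_measure; rewrite ?inE //; exact: measurableI.
Qed.

Let circle_exp_add (s t : RR) :
  circle_exp (t + s) = circle_mul (circle_exp s) (circle_exp t).
Proof.
apply/val_inj => /=; rewrite mulrDr cosD sinD.
rewrite -[RHS]/(_ +i* _) /=; congr (_ +i* _); ring.
Qed.

Let circle_exp1 (t : RR) : circle_exp (t + 1) = circle_exp t.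
Proof.
apply/val_inj => /=; rewrite mulrDr mulr1 mulr_natl.
by rewrite cosD2pi sinD2pi.
Qed.

Let circle_exp_surj (w : circle R) :
  exists2 s : R, 0 <= s <= 1 & w = circle_exp s.
Proof.
case: w => -[a b] ab1.
have ab : a ^+ 2 + b ^+ 2 = 1.
  have := add_Re2_Im2 (a +i* b); rewrite (eqP ab1) expr1n /=.
  by move=> /complexI.
have a1 : -1 <= a <= 1.
  rewrite -ler_norml -(@ler_pXn2r _ 2) ?nnegrE// expr1n real_normK ?num_real//.
  by rewrite -ab lerDl sqr_ge0.
have ca : cos (acos a) = a by rewrite acosK// in_itv.
have sa : sin (acos a) = `|b|.
  by rewrite sin_acos// -ab addrAC subrr add0r sqrtr_sqr.
have pi0 := pi_gt0 R.
have p2 : 2 * pi != 0 :> R by rewrite mulf_neq0 ?lt0r_neq0.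
have p2' : 0 < 2 * pi :> R by rewrite mulr_gt0.
have aca : 0 <= acos a / (2 * pi) <= 1.
  apply/andP; split; first by apply: divr_ge0; [exact: acos_ge0|exact: ltW].
  rewrite ler_pdivrMr// mul1r; have := acos_lepi a1; lra.
have [b0|b0] := leP 0 b.
  exists (acos a / (2 * pi)) => //; apply/val_inj => /=.
  by rewrite mulrC divfK// ca sa ger0_norm.
exists (1 - acos a / (2 * pi)).
  by move: aca => /andP[x0 x1]; rewrite subr_ge0 x1 lerBlDr lerDl.
apply/val_inj => /=; rewrite mulrBr mulr1 [2 * pi * (_ / _)]mulrC divfK//.
by rewrite mulr_natl addrC cosD2pi sinD2pi cosN sinN ca sa ltr0_norm// opprK.
Qed.

Lemma circle_haar_translation (w : circle R) (A : set (circle R)) :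
  measurable A -> circle_haar (circle_mul w @^-1` A) = circle_haar A.
Proof.
have [s /andP[s0 s1] ->] := circle_exp_surj w.
move=> mA; rewrite /circle_haar /= /distribution /pushforward /=.
pose E : set RR := @circle_exp R @^-1` A.
have mE : measurable E by rewrite -[E]setTI; apply: measurable_circle_exp.
have -> : @circle_exp R @^-1` (circle_mul (circle_exp s) @^-1` A) =
    (fun t : RR => t + s) @^-1` E.
  by apply/seteqP; split => t /=; rewrite /E /= circle_exp_add.
have mtE : measurable ((fun t : RR => t + s) @^-1` E).
  by rewrite -[X in measurable X]setTI; apply: mtrans.
rewrite !uniform01//.
have -> : (fun t : RR => t + s) @^-1` E `&` `[0, 1[ =
   (fun t : RR => t + s) @^-1` (E `&` `[s, s + 1[).
  apply/seteqP; split => t /= [? /[!in_itv]/= /andP[? ?]]; split => //;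
   rewrite ?in_itv/=.
    by rewrite lerDr addrC ltrD2l; apply/andP.
  by rewrite -(lerD2r s) add0r -(ltrD2r s) [1 + s]addrC; apply/andP.
rewrite lebesgue_translation; last exact: measurableI.
have split3 (a b c : R) : a <= b -> b <= c ->
    mu (E `&` `[a, c[) = (mu (E `&` `[a, b[) + mu (E `&` `[b, c[))%E.
  move=> ab bc.
  have -> : `[a, c[%classic = `[a, b[%classic `|` `[b, c[%classic.
    by rewrite -itv_bndbnd_setU ?bnd_simp.
  rewrite setIUr measureU //; [exact: measurableI|exact: measurableI|].
  apply/seteqP; split => // t /= [[_ /[!in_itv]/= /andP[_ tb]] [_ /andP[bt _]]].
  by move: (lt_le_trans tb bt); rewrite ltxx.
rewrite (split3 s 1 (s + 1)) ?lerDr// (split3 0 s 1)// addeC; congr (_ + _)%E.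
rewrite -(lebesgue_translation 1); last exact: measurableI.
congr (mu _); apply/seteqP; split => t /=; rewrite /E /= circle_exp1 !in_itv /=.
  by move=> [? /andP[t1 ts]]; split => //; move: t1 ts; rewrite lerDr ltrD2r => -> ->.
by move=> [? /andP[t1 ts]]; split => //; rewrite lerDr ltrD2r t1 ts.
Qed.

Lemma haarS n (A : set (torus R n.+1)) :
  haar n.+1 A =
  (\int[circle_haar]_x haar n (xsection (@torus_cons R n @^-1` A) x))%E.
Proof. by []. Qed.

Definition torus_mul n (w z : torus R n) : torus R n :=
  [tuple circle_mul (tnth w i) (tnth z i) | i < n].

Let measurable_circle_mul (w : circle R) : measurable_fun setT (circle_mul w).
Proof.
have [mre mim] : measurable_fun setT (fun z : circle R => complex.Re z) /\
    measurable_fun setT (fun z : circle R => complex.Im z).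
  by have /measurable_fun_pairP := @measurable_circle_coord R.
case: w => -[a b] w1.
apply: measurable_to_circle => /=.
- rewrite (_ : (fun x => _) =
    (fun x : circle R => a * complex.Re x - b * complex.Im x)); last first.
    by apply/funext => -[[]].
  by apply: measurable_funB; apply: measurable_funM.
- rewrite (_ : (fun x => _) =
    (fun x : circle R => a * complex.Im x + b * complex.Re x)); last first.
    by apply/funext => -[[]].
  by apply: measurable_funD; apply: measurable_funM.
Qed.

Lemma haar_translation n (w : torus R n) (A : set (torus R n)) :
  measurable A -> haar n (torus_mul w @^-1` A) = haar n A.
Proof.
have mmul m (u : torus R m) : measurable_fun setT (torus_mul u).
  apply/measurable_fun_tnthP => i.
  have -> : (@tnth m (circle R))^~ i \o torus_mul u =
      circle_mul (tnth u i) \o (@tnth m (circle R))^~ i.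
    by apply/funext => z /=; rewrite tnth_mktuple.
  exact: measurableT_comp (measurable_tnth i).
elim: n w A => [|n IH] w A mA.
  by congr (haar _ _); apply/seteqP; split => z /=; rewrite (tuple0 (torus_mul w z)) (tuple0 z).
rewrite !haarS.
have mAc : measurable (@torus_cons R n @^-1` A).
  by rewrite -[X in measurable X]setTI; apply: measurable_torus_cons.
pose w0 := thead w; pose w' : torus R n := [tuple of behead w].
have torus_mulE x (y : torus R n) : torus_mul w (torus_cons (x, y)) =
    torus_cons (circle_mul w0 x, torus_mul w' y).
  apply/eq_from_tnth => i; rewrite tnth_mktuple.
  case: (unliftP ord0 i) => [j|] ->; last by rewrite !tnth0.
  by rewrite !tnthS tnth_mktuple {1}(tuple_eta w) tnthS.
transitivity (\int[circle_haar]_x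
   haar n (xsection (@torus_cons R n @^-1` A) (circle_mul w0 x)))%E.
  apply: eq_integral => x _ /=.
  rewrite -[RHS](IH w'); last exact: measurable_xsection.
  congr (haar n _); apply/seteqP; split => y; rewrite /xsection /= !inE /=;
    by rewrite torus_mulE.
pose F := haar n \o xsection (@torus_cons R n @^-1` A).
have mF : measurable_fun setT F by apply: measurable_fun_xsection.
pose mfx := isMeasurableFun.Build _ _ _ _ _ (measurable_circle_mul w0).
pose M : {mfun circle R >-> circle R} := HB.pack (circle_mul w0) mfx.
rewrite -(@ge0_integral_distribution _ _ _ _ _ circle_haar M F)//.
apply: eq_measure_integral => B mB _.
exact: circle_haar_translation.
Qed.

End haar_invariance.

Section collections.
Context {R : realType}.

(* Partially defined functions; [None] means undefined. *)
Definition pfun n := torus R n -> option R[i].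

Definition cintegrable n (h : torus R n -> R[i]) : Prop :=
  (haar n).-integrable setT (fun z => (complex.Re (h z))%:E) /\
  (haar n).-integrable setT (fun z => (complex.Im (h z))%:E).

Definition cintegral n (h : torus R n -> R[i]) : R[i] :=
  (\int[haar n]_z complex.Re (h z))%R +i* (\int[haar n]_z complex.Im (h z))%R.

Definition ae_represents n (h : torus R n -> R[i]) (g : pfun n) : Prop :=
  {ae haar n, forall z, g z = Some (h z)}.

(* g is almost everywhere defined and gives an element of L^1. *)
Definition integrable_pfun n (g : pfun n) : Prop :=
  exists h, ae_represents h g /\ cintegrable h.

Definition has_integral n (g : pfun n) (I : R[i]) : Prop :=
  exists h, [/\ ae_represents h g, cintegrable h & cintegral h = I].

Let monomial_map_subproof n m (A : 'M[int]_(n, m)) (z : torus R m) (i : 'I_n) :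
  `|\prod_(j < m) (tnth z j : R[i]) ^ A i j| == 1.
Proof.
rewrite normr_prod big1// => j _.
have nz : `|(tnth z j : R[i])| = 1 by apply/eqP/circleP.
by case: (A i j) => k; rewrite -?exprnP -?exprnN ?normrX ?normfV ?normrX nz expr1n ?invr1.
Qed.

Definition monomial_map n m (A : 'M[int]_(n, m)) (z : torus R m) : torus R n :=
  [tuple Circle (monomial_map_subproof A z i) | i < n].

Definition sup_norm n (v : 'rV[int]_n) : nat := \max_(i < n) `|v ord0 i|%N.

(* The infimum of the empty set is +oo; otherwise the infimum is a minimum, see
   [boyd_height_min] and [boyd_height_pinfty]. *)
Definition boyd_height n m (A : 'M[int]_(n, m)) : \bar R :=
  ereal_inf [set ((sup_norm v)%:R)%:E | v in [set v | v != 0 /\ v *m A = 0]].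

(* Only the values of C at positive n matter. *)
Record boyd_lawton (C : forall n, set (pfun n)) : Prop := {
  boyd_lawton_integrable : forall n (g : pfun n), (0 < n)%N -> C n g ->
    integrable_pfun g;
  boyd_lawton_limit : forall n (g : pfun n), (1 < n)%N -> C n g ->
    exists I, has_integral g I /\
      forall eps : R, 0 < eps -> exists M : R, forall r : 'cV[int]_n,
        (M%:E <= boyd_height r)%E ->
        exists J, has_integral (g \o monomial_map r) J /\ normc (I - J) < eps;
  boyd_lawton_comp : forall n (g : pfun n), (0 < n)%N -> C n g ->
    exists B : R, forall m (A : 'M[int]_(n, m)), (0 < m)%N ->
      (B%:E <= boyd_height A)%E -> C m (g \o monomial_map A)
}.

End collections.

Arguments pfun R n : clear implicits.

Lemma boyd_height_min (R : realType) n m (A : 'M[int]_(n, m)) (v : 'rV[int]_n) :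
  v != 0 -> v *m A = 0 ->
  exists v0 : 'rV[int]_n, [/\ v0 != 0, v0 *m A = 0,
    (forall u : 'rV[int]_n, u != 0 -> u *m A = 0 -> (sup_norm v0 <= sup_norm u)%N) &
    @boyd_height R n m A = ((sup_norm v0)%:R)%:E].
Proof.
move=> v0 vA.
pose P k := `[< exists u : 'rV[int]_n, [/\ u != 0, u *m A = 0 & sup_norm u = k] >].
have exP : exists k, P k by exists (sup_norm v); apply/asboolP; exists v.
have [k /asboolP[u [u0 uA uk]] kmin] := ex_minnP exP.
have umin x : x != 0 -> x *m A = 0 -> (sup_norm u <= sup_norm x)%N.
  by move=> x0 xA; rewrite uk; apply: kmin; apply/asboolP; exists x.
exists u; split => //.
apply/eqP; rewrite eq_le; apply/andP; split.
  by apply: ereal_inf_lbound; exists u.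
apply: le_ereal_inf_tmp => _ [x [x0 xA] <-].
by rewrite lee_fin ler_nat; apply: umin.
Qed.

Lemma boyd_height_pinfty (R : realType) n m (A : 'M[int]_(n, m)) :
  (forall v : 'rV[int]_n, v *m A = 0 -> v = 0) -> @boyd_height R n m A = +oo%E.
Proof.
move=> A0; rewrite /boyd_height.
have -> : [set v : 'rV[int]_n | v != 0 /\ v *m A = 0] = set0.
  by apply/seteqP; split => // v [/eqP v0 /A0].
by rewrite image_set0 ereal_inf0.
Qed.

Lemma has_integral_unique (R : realType) n (g : pfun R n) I J :
  has_integral g I -> has_integral g J -> I = J.
Proof.
move=> [h [gh [hr hi] <-]] [k [gk [kr ki] <-]].
have hk : {ae haar n, forall z : torus R n, h z = k z}.
  by apply: filterS2 gh gk => z -> [].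
rewrite /cintegral /Rintegral; congr (fine _ +i* fine _);
  apply: ae_eq_integral => //.
- exact: (measurable_int _ hr).
- exact: (measurable_int _ kr).
- by apply: filterS hk => z -> _.
- exact: (measurable_int _ hi).
- exact: (measurable_int _ ki).
- by apply: filterS hk => z -> _.
Qed.

Section log_collections.
Context {R : realType}.

(* Laurent polynomials in n variables, as finitely supported families of
   coefficients indexed by the exponents in Z^n. *)
Definition laurent n := {fsfun 'rV[int]_n -> R[i] with 0}.

Definition laurent_eval n (P : laurent n) (z : torus R n) : R[i] :=
  \sum_(e <- finsupp P) P e * \prod_(i < n) (tnth z i : R[i]) ^ e ord0 i.

(* [lne 0 = -oo], and the maximum is finite as soon as one of the values is
   nonzero. *)
Definition max_log n k (P : 'I_k -> laurent n) : pfun R n := fun z =>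
  if [forall i, laurent_eval (P i) z == 0] then None
  else Some (fine (\big[maxe/-oo%E]_(i < k)
                     lne (normc (laurent_eval (P i) z))%:E))%:C.

Definition prod_log n k (P : 'I_k -> laurent n) : pfun R n := fun z =>
  if [exists i, laurent_eval (P i) z == 0] then None
  else Some (\prod_(i < k) ln (normc (laurent_eval (P i) z)))%:C.

Definition max_log_collection n : set (pfun R n) :=
  [set g | exists k (P : 'I_k -> laurent n),
     [/\ (0 < k)%N, forall i, P i != [fsfun] & g = max_log P]].

Definition prod_log_collection n : set (pfun R n) :=
  [set g | exists k (P : 'I_k -> laurent n),
     [/\ (0 < k)%N, forall i, P i != [fsfun] & g = prod_log P]].

End log_collections.

Arguments laurent R n : clear implicits.

(* Main.v *)
From HB Require Import structures.
From mathcomp Require Import all_boot all_order all_algebra.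
From mathcomp Require Import finmap complex.
From mathcomp Require Import all_classical all_reals all_analysis.
From mathcomp Require Import measurable_realfun ring lra zify.

Require Import Defs.

(** Why the theorem holds.

    A logarithm log|P| is approximated by polynomials in |P|^2, which are
    trigonometric polynomials on the torus because conj z = 1/z there.  The
    integral of a trigonometric polynomial F is its constant coefficient
    ([Rintegral_exp_sum]), and composing with q_A changes it only if a nonzero
    exponent v of F satisfies v A = 0; so the integrals of F and of the
    composite F o q_A are equal as soon as the Boyd height of A is large
    ([trigonometric_integral]).  Everything then depends on bounding the
    approximation error in L^1, uniformly in the homomorphism q_A.

    The approximating polynomials are Taylor polynomials of ln at 1.  They
    satisfy |ln x - p(x)| <= eps (1 + |ln x|)^2 on all of ]0, 1]
    ([log_poly_approx]), so what is needed is a bound on the moments of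
    log|P o q_A| which does not depend on A ([log_moment]).  It follows from an
    estimate in the spirit of Lawton's lemma ([small_ball]): the set where an
    exponential sum with k + 1 terms is smaller than 2^(-4^k j) times the modulus
    of a coefficient whose exponent occurs only once has measure at most
    4 * 2^-j, whatever the exponents and whatever the dimension.  Fix a nonzero
    coefficient of P.  For A of large height, it is also a coefficient of P o q_A
    whose exponent occurs only once, and the number of terms is the same; so the
    bound is uniform in A.

    The estimate is proved by induction on the number of terms.  Let E be the
    set where f is small.  If z and hz are both in E, then
    f(hz) - chi(h) f(z) is small as well; choosing for chi the character of one
    of the terms makes this term cancel, and the induction hypothesis bounds the
    measure of E inter h^-1 E, except when the surviving leading coefficient
    c0 (chi0(h) - chi(h)) is itself small, which is rare ([chi_small_ball]).
    Averaging over h turns these measures into the square of the measure of E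
    ([haar_self_correlation]).

    Both collections fit this scheme ([approximation_limit]).  In a product each
    factor is replaced by its polynomial approximation ([prod_log_approx]).  A
    maximum is first replaced by the logarithm of a power mean of the |P_i|^2,
    which differs from it by a small constant ([max_log_approx]).  Taking for
    q_A the identity gives the integrability on the torus itself.  Finally, each
    collection is closed under composition with q_A for A of large height,
    because P o q_A is then again a nonzero Laurent polynomial
    ([laurent_comp_neq0]). *)

Set Implicit Arguments.
Unset Strict Implicit.
Unset Printing Implicit Defensive.

Import Order.TTheory GRing.Theory Num.Theory.
Import numFieldNormedType.Exports.
Import ComplexField.Normc.

Local Open Scope classical_set_scope.
Local Open Scope ring_scope.
Local Open Scope complex_scope.

(** * Moduli of complex numbers *)

Section moduli.
Context {R : realType}.

Lemma normc_normr (x : R[i]) : `|x| = (normc x)%:C.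
Proof. by case: x. Qed.

Lemma normc_ge0 (x : R[i]) : 0 <= normc x.
Proof. by case: x => a b; exact: sqrtr_ge0. Qed.

Lemma normc_gt0 (x : R[i]) : x != 0 -> 0 < normc x.
Proof.
by move=> x0; rewrite lt_neqAle normc_ge0 andbT eq_sym; apply: contra x0 => /eqP/eq0_normc ->.
Qed.

Lemma normc_real (x : R) : normc x%:C = `|x|.
Proof. by rewrite /normc /= expr0n addr0 sqrtr_sqr. Qed.

Lemma normc_geRe (x : R[i]) : `|complex.Re x| <= normc x.
Proof. by rewrite -lecR -normc_normr normc_ge_Re. Qed.

Lemma normcB (x y : R[i]) : normc (x - y) = normc (y - x).
Proof. by rewrite -[LHS]normcN opprB. Qed.

Lemma normc_sqr (x : R[i]) : (normc x ^+ 2)%:C = x * x^*%C.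
Proof. by rewrite -sqr_normc normc_normr rmorphXn. Qed.

Lemma normcX_sub1 (u : R[i]) m : normc u = 1 -> normc (u ^+ m - 1) <= m%:R * normc (u - 1).
Proof.
move=> u1; elim: m => [|m IH]; first by rewrite expr0 subrr normc0 mul0r.
rewrite (_ : u ^+ m.+1 - 1 = u * (u ^+ m - 1) + (u - 1)); last by rewrite exprS; ring.
apply: le_trans (le_normcD _ _) _.
by rewrite normcM u1 mul1r -natr1 mulrDl mul1r lerD2r.
Qed.

End moduli.

(** * Characters and exponential sums *)

Section characters.
Context {R : realType}.

Lemma circle_neq0 (z : circle R) : (z : R[i]) != 0.
Proof. by rewrite -normr_gt0 (eqP (circleP z)) ltr01. Qed.

Lemma circle_conj (z : circle R) : (z : R[i])^-1 = (z : R[i])^*%C.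
Proof.
apply: (mulfI (circle_neq0 z)); rewrite mulfV ?circle_neq0//.
by rewrite -sqr_normc (eqP (circleP z)) expr1n.
Qed.

Lemma circle_normc (z : circle R) : normc (z : R[i]) = 1.
Proof. by have /eqP := circleP z; case: z => -[a b] /= _ [] . Qed.

(** The character of the torus with exponent [e]. *)
Definition chi n (e : 'rV[int]_n) (z : torus R n) : R[i] :=
  \prod_(i < n) (tnth z i : R[i]) ^ e ord0 i.

Lemma chi0 n (z : torus R n) : chi 0 z = 1.
Proof. by rewrite /chi big1// => i _; rewrite mxE expr0z. Qed.

Lemma chiD n (e f : 'rV[int]_n) z : chi (e + f) z = chi e z * chi f z.
Proof.
rewrite /chi -big_split; apply: eq_bigr => i _ /=.
by rewrite mxE expfzDr ?circle_neq0.
Qed.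

Lemma chi_neq0 n (e : 'rV[int]_n) z : chi e z != 0.
Proof. by apply/prodf_neq0 => i _; rewrite expfz_neq0 ?circle_neq0. Qed.

Lemma chi_torus_mul n (e : 'rV[int]_n) w z :
  chi e (torus_mul w z) = chi e w * chi e z.
Proof.
rewrite /chi -big_split; apply: eq_bigr => i _ /=.
by rewrite tnth_mktuple /= expfzMl.
Qed.

Lemma chi_monomial_map n m (A : 'M[int]_(n, m)) (e : 'rV[int]_n) z :
  chi e (monomial_map A z) = chi (e *m A) z.
Proof.
transitivity (\prod_(i < n) \prod_(j < m) (tnth z j : R[i]) ^ (e ord0 i * A i j)).
  apply: eq_bigr => i _; rewrite tnth_mktuple /=.
  rewrite (big_morph (fun x : R[i] => x ^ e ord0 i) (fun x y => expfzMl x y _) (exp1rz _ _)).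
  by apply: eq_bigr => j _; rewrite exprz_exp mulrC.
rewrite exchange_big; apply: eq_bigr => j _ /=; rewrite mxE.
rewrite (big_morph (fun k : int => (tnth z j : R[i]) ^ k)
  (fun x y => expfzDr x y (circle_neq0 _)) (expr0z _)).
by [].
Qed.

Lemma normc_chi n (e : 'rV[int]_n) z : normc (chi e z) = 1.
Proof.
rewrite /chi (big_morph (@normc R) (@normcM R) (@normc1 R)) big1// => i _.
have nz := circle_normc (tnth z i).
have nX (x : R[i]) k : normc x = 1 -> normc (x ^+ k) = 1.
  by move=> x1; elim: k => [|k IH]; rewrite ?expr0 ?normc1// exprS normcM x1 IH mulr1.
by case: (e ord0 i) => k; rewrite -?exprnP ?NegzE -?exprnN ?normcV nX// invr1.
Qed.

Lemma chi_conj n (e : 'rV[int]_n) z : (chi e z)^*%C = chi (- e) z.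
Proof.
apply: (mulfI (chi_neq0 e z)); rewrite -chiD subrr chi0 -sqr_normc.
by rewrite normc_normr normc_chi expr1n.
Qed.

(** A list of pairs (coefficient, exponent), possibly with repeated exponents,
    stands for an exponential sum: products and substitutions are then plain
    list operations, with no collection of like terms. *)
Definition exp_sum n (s : seq (R[i] * 'rV[int]_n)) (z : torus R n) : R[i] :=
  \sum_(x <- s) x.1 * chi x.2 z.

Lemma exp_sum_cons n x (s : seq (R[i] * 'rV[int]_n)) z :
  exp_sum (x :: s) z = x.1 * chi x.2 z + exp_sum s z.
Proof. by rewrite /exp_sum big_cons. Qed.

Lemma exp_sum_nil n (z : torus R n) : exp_sum [::] z = 0.
Proof. by rewrite /exp_sum big_nil. Qed.

End characters.

(** * Measurability and invariance on the torus *)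

Section measurability.
Context {R : realType}.

Definition cmeasurable d (T : measurableType d) (f : T -> R[i]) :=
  measurable_fun setT (fun x => complex.Re (f x)) /\
  measurable_fun setT (fun x => complex.Im (f x)).

Section closure.
Context d (T : measurableType d).
Implicit Types f g : T -> R[i].

Lemma cmeasurable_cst (c : R[i]) : cmeasurable (fun _ : T => c).
Proof. by split; exact: measurable_cst. Qed.

Lemma cmeasurableD f g : cmeasurable f -> cmeasurable g ->
  cmeasurable (fun x => f x + g x).
Proof.
move=> [fr fi] [gr gi]; split.
- rewrite (_ : (fun x => _) = (fun x => complex.Re (f x) + complex.Re (g x))).
    exact: measurable_funD.
  by apply/funext => x; rewrite raddfD.
- rewrite (_ : (fun x => _) = (fun x => complex.Im (f x) + complex.Im (g x))).
    exact: measurable_funD.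
  by apply/funext => x; rewrite raddfD.
Qed.

Lemma cmeasurableM f g : cmeasurable f -> cmeasurable g ->
  cmeasurable (fun x => f x * g x).
Proof.
move=> [fr fi] [gr gi]; split.
- rewrite (_ : (fun x => _) = (fun x => complex.Re (f x) * complex.Re (g x) -
    complex.Im (f x) * complex.Im (g x))).
    by apply: measurable_funB; apply: measurable_funM.
  by apply/funext => x; case: (f x); case: (g x).
- rewrite (_ : (fun x => _) = (fun x => complex.Re (f x) * complex.Im (g x) +
    complex.Im (f x) * complex.Re (g x))).
    by apply: measurable_funD; apply: measurable_funM.
  by apply/funext => x; case: (f x); case: (g x).
Qed.

Lemma cmeasurable_conj f : cmeasurable f -> cmeasurable (fun x => (f x)^*%C).
Proof.
move=> [fr fi]; split.
- rewrite (_ : (fun x => _) = (fun x => complex.Re (f x)))//.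
  by apply/funext => x; case: (f x).
- rewrite (_ : (fun x => _) = (fun x => - complex.Im (f x))).
    exact: measurableT_comp.
  by apply/funext => x; case: (f x).
Qed.

Lemma cmeasurable_sum (I : Type) (r : seq I) (F : I -> T -> R[i]) :
  (forall i, cmeasurable (F i)) -> cmeasurable (fun x => \sum_(i <- r) F i x).
Proof.
move=> mF; elim: r => [|i r IH].
  by under eq_fun do rewrite big_nil; exact: cmeasurable_cst.
by under eq_fun do rewrite big_cons; exact: cmeasurableD.
Qed.

Lemma cmeasurable_prod (I : Type) (r : seq I) (F : I -> T -> R[i]) :
  (forall i, cmeasurable (F i)) -> cmeasurable (fun x => \prod_(i <- r) F i x).
Proof.
move=> mF; elim: r => [|i r IH].
  by under eq_fun do rewrite big_nil; exact: cmeasurable_cst.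
by under eq_fun do rewrite big_cons; exact: cmeasurableM.
Qed.

Lemma measurable_normc f : cmeasurable f -> measurable_fun setT (fun x => normc (f x)).
Proof.
move=> [fr fi].
rewrite (_ : (fun x => _) = Num.sqrt \o (fun x => complex.Re (f x) ^+ 2 + complex.Im (f x) ^+ 2)).
  apply: (measurableT_comp (continuous_measurable_fun (@sqrt_continuous R))).
  by apply: measurable_funD; apply: measurable_funX.
by apply/funext => x /=; case: (f x).
Qed.

Lemma measurable_sublevel (f : T -> R) (a : R) :
  measurable_fun setT f -> measurable [set x | f x <= a].
Proof.
move=> mf; rewrite (_ : [set x | _] = setT `&` f @^-1` `]-oo, a]%classic).
  exact: mf.
by apply/seteqP; split => x /=; rewrite in_itv /= => // -[].
Qed.

Lemma measurable_superlevel (f : T -> R) (a : R) :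
  measurable_fun setT f -> measurable [set x | a <= f x].
Proof.
move=> mf; rewrite (_ : [set x | _] = [set x | - f x <= - a]).
  by apply: measurable_sublevel; exact: measurableT_comp.
by apply/seteqP; split => x /=; rewrite lerN2.
Qed.

End closure.

Lemma cmeasurable_circle : cmeasurable (@circle_val R).
Proof. by have /measurable_fun_pairP := @measurable_circle_coord R. Qed.

Lemma cmeasurable_comp d d' (T : measurableType d) (U : measurableType d')
  (f : U -> R[i]) (g : T -> U) : cmeasurable f -> measurable_fun setT g ->
  cmeasurable (f \o g).
Proof.
by move=> [fr fi] mg; split; [exact: (measurableT_comp fr)|exact: (measurableT_comp fi)].
Qed.

Lemma cmeasurable_tnth n (i : 'I_n) :
  cmeasurable (fun z : torus R n => tnth z i : R[i]).
Proof. exact: (cmeasurable_comp cmeasurable_circle (measurable_tnth i)). Qed.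

Lemma cmeasurable_chi n (e : 'rV[int]_n) : cmeasurable (chi e : torus R n -> R[i]).
Proof.
have mX d (T : measurableType d) (f : T -> R[i]) k : cmeasurable f ->
    cmeasurable (fun x => f x ^+ k).
  move=> mf; elim: k => [|k IH]; first by under eq_fun do rewrite expr0; exact: cmeasurable_cst.
  by under eq_fun do rewrite exprS; exact: cmeasurableM.
apply: cmeasurable_prod => i; case: (e ord0 i) => k.
  by under eq_fun do rewrite -exprnP; apply/mX/cmeasurable_tnth.
under eq_fun do rewrite NegzE -exprnN -exprVn circle_conj.
exact/mX/cmeasurable_conj/cmeasurable_tnth.
Qed.

Lemma cmeasurable_exp_sum n s : cmeasurable (exp_sum s : torus R n -> R[i]).
Proof.
by apply: cmeasurable_sum => i; apply: cmeasurableM;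
  [exact: cmeasurable_cst|exact: cmeasurable_chi].
Qed.

Lemma measurable_torus_mul n :
  measurable_fun setT (fun p : torus R n * torus R n => torus_mul p.1 p.2).
Proof.
apply/measurable_fun_tnthP => i.
have [mr mi] : cmeasurable (fun p : torus R n * torus R n =>
    (tnth p.1 i : R[i]) * (tnth p.2 i : R[i])).
  apply: cmeasurableM.
    exact: (cmeasurable_comp (cmeasurable_tnth i) measurable_fst).
  exact: (cmeasurable_comp (cmeasurable_tnth i) measurable_snd).
apply: measurable_to_circle => /=.
- by under eq_fun do rewrite tnth_mktuple.
- by under eq_fun do rewrite tnth_mktuple.
Qed.

Lemma measurable_torus_mull n (w : torus R n) : measurable_fun setT (torus_mul w).
Proof.
exact: (measurableT_comp (@measurable_torus_mul n) (pair1_measurable w)).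
Qed.

Lemma measurable_monomial_map n m (A : 'M[int]_(n, m)) :
  measurable_fun setT (monomial_map A : torus R m -> torus R n).
Proof.
apply/measurable_fun_tnthP => i.
have tE (z : torus R m) : (tnth (monomial_map A z) i : R[i]) = chi (row i A) z.
  by rewrite tnth_mktuple /= /chi; apply: eq_bigr => j _; rewrite mxE.
have [mr mi] := @cmeasurable_chi m (row i A).
by apply: measurable_to_circle => /=; under eq_fun do rewrite tE.
Qed.

Lemma haar_ge0_integral_translation n (w : torus R n) (f : torus R n -> \bar R) :
  measurable_fun setT f -> (forall z, 0 <= f z)%E ->
  (\int[haar n]_z f (torus_mul w z) = \int[haar n]_z f z)%E.
Proof.
move=> mf f0.
have := ge0_integral_pushforward (measurable_torus_mull w) (haar n)
  measurableT mf (fun z _ => f0 z).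
rewrite preimage_setT => <-.
apply: eq_measure_integral => [|mT A mA _].
  exact: measurable_torus_mull.
exact: haar_translation.
Qed.

End measurability.

(** * Orthogonality of characters *)

Section fourier.
Context {R : realType}.

Lemma integrable_bounded d (T : measurableType d) (mu : probability T R)
  (f : T -> R) (M : R) : measurable_fun setT f -> (forall z, `|f z| <= M) ->
  mu.-integrable setT (EFin \o f).
Proof.
move=> mf fM; apply: measurable_bounded_integrable => //.
  by rewrite (le_lt_trans (probability_le1 _ _)) ?ltry.
exists M; split; first exact: num_real.
by move=> x Mx z _; exact: le_trans (fM z) (ltW Mx).
Qed.

Lemma EFin_Rintegral d (T : measurableType d) (mu : {measure set T -> \bar R})
  (f : T -> R) : mu.-integrable setT (EFin \o f) ->
  (\int[mu]_x (f x)%:E = (\int[mu]_x f x)%R%:E)%E.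
Proof. by move=> fi; rewrite /Rintegral fineK//; exact: integrable_fin_num. Qed.

Lemma circle_expX (t : R) k :
  (circle_exp t : R[i]) ^+ k = circle_exp (k%:R * t).
Proof.
elim: k => [|k IH]; first by rewrite expr0 /= mul0r mulr0 cos0 sin0.
rewrite exprS IH /= -[LHS]/(_ +i* _)
  (_ : 2 * pi * (k.+1%:R * t) = 2 * pi * t + 2 * pi * (k%:R * t)).
  by rewrite cosD sinD; congr (_ +i* _); ring.
by rewrite -natr1; ring.
Qed.

(** Translating by such a [w] changes the sign of the character, which makes its
    integral vanish. *)
Lemma chi_eqN1 n (e : 'rV[int]_n) : e != 0 -> exists w : torus R n, chi e w = -1.
Proof.
move=> /rV0Pn[i ei].
have k0 : (0 < `|e ord0 i|)%N by rewrite absz_gt0.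
have k0' : (`|e ord0 i|%:R : R) != 0 by rewrite pnatr_eq0 -lt0n.
pose u : circle R := circle_exp (2^-1 / `|e ord0 i|%:R).
exists [tuple if j == i then u else circle1 | j < n].
rewrite /chi (bigD1 i)//= big1 ?mulr1; last first.
  by move=> j /negbTE ji; rewrite tnth_mktuple ji /= exp1rz.
rewrite tnth_mktuple eqxx.
have uk : (u : R[i]) ^+ `|e ord0 i| = -1.
  rewrite circle_expX /= (_ : 2 * pi * _ = pi); last by field.
  by rewrite cospi sinpi; apply/eqP; rewrite eq_complex /= oppr0 !eqxx.
move: uk; case: (e ord0 i) => m /=; first by rewrite -exprnP.
by rewrite NegzE -exprnN => ->; rewrite invrN1.
Qed.

Lemma normc_exp_sum n s (z : torus R n) : normc (exp_sum s z) <= \sum_(x <- s) normc x.1.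
Proof.
rewrite /exp_sum; elim: s => [|x s IH]; first by rewrite !big_nil normc0.
rewrite !big_cons; apply: le_trans (le_normcD _ _) _.
by rewrite normcM normc_chi mulr1 lerD2l.
Qed.

Lemma measurable_Re_exp_sum n s :
  measurable_fun setT (fun z : torus R n => complex.Re (exp_sum s z)).
Proof. by have [] := @cmeasurable_exp_sum R n s. Qed.

Lemma integrable_Re_exp_sum n s :
  (haar n).-integrable setT (fun z : torus R n => (complex.Re (exp_sum s z))%:E).
Proof.
apply: (@integrable_bounded _ _ _ _ (\sum_(x <- s) normc x.1)) => [|z].
  exact: measurable_Re_exp_sum.
exact: le_trans (normc_geRe _) (normc_exp_sum _ _).
Qed.

Lemma exp_sum1 n c (e : 'rV[int]_n) z : exp_sum [:: (c, e)] z = c * chi e z :> R[i].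
Proof. by rewrite exp_sum_cons exp_sum_nil addr0. Qed.

(** The translation by a [w] with [chi e w = -1] exchanges the positive and the
    negative parts. *)
Lemma Rintegral_chi_neq0 n (c : R[i]) (e : 'rV[int]_n) : e != 0 ->
  (\int[haar n]_z complex.Re (c * chi e z) = 0)%R.
Proof.
move=> e0; have [w ew] := @chi_eqN1 n e e0.
pose f (z : torus R n) := complex.Re (c * chi e z).
have mf : measurable_fun setT (EFin \o f).
  apply/measurable_EFinP; have := @measurable_Re_exp_sum n [:: (c, e)].
  by under eq_fun do rewrite exp_sum1.
have fw z : f (torus_mul w z) = - f z.
  by rewrite /f chi_torus_mul ew mulN1r mulrN raddfN.
have fint : (haar n).-integrable setT (EFin \o f).
  have := @integrable_Re_exp_sum n [:: (c, e)].
  by under eq_fun do rewrite exp_sum1.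
rewrite /Rintegral -/(f _) integralE.
have -> : (\int[haar n]_z ((EFin \o f)^\- z) = \int[haar n]_z ((EFin \o f)^\+ z))%E.
  rewrite -[LHS](@haar_ge0_integral_translation R n w) //.
    by apply: eq_integral => z _; rewrite funenegE funeposE /= fw opprK.
  exact: measurable_funeneg.
rewrite subee//; apply: integrable_fin_num => //; exact: integrable_funepos.
Qed.

Lemma Rintegral_exp_sum n s : (\int[haar n]_z complex.Re (exp_sum s z : R[i]) =
  complex.Re (\sum_(x <- s | x.2 == 0) x.1))%R.
Proof.
elim: s => [|[c e] s IH].
  rewrite big_nil; under eq_Rintegral do rewrite exp_sum_nil.
  by rewrite Rintegral_cst// mul0r.
under eq_Rintegral do rewrite exp_sum_cons -exp_sum1 raddfD.
rewrite RintegralD//; [|exact: integrable_Re_exp_sum|exact: integrable_Re_exp_sum].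
rewrite IH big_cons /=; case: eqVneq => [->|e0].
  under eq_Rintegral do rewrite exp_sum1 chi0 mulr1.
  by rewrite Rintegral_cst// [X in fine X](probability_setT (haar n)) mulr1 raddfD.
under eq_Rintegral do rewrite exp_sum1.
by rewrite Rintegral_chi_neq0// add0r.
Qed.

End fourier.

(** * Small values of a single character *)

Section trig_algebra.
Context {R : realType} (n : nat).
Implicit Types (s t : seq (R[i] * 'rV[int]_n)) (z : torus R n).

Lemma exp_sum_mul s t z : exp_sum s z * exp_sum t z =
  exp_sum [seq (x.1 * y.1, x.2 + y.2) | x <- s, y <- t] z.
Proof.
rewrite /exp_sum big_allpairs_dep /= mulr_suml; apply: eq_bigr => x _.
by rewrite mulr_sumr; apply: eq_bigr => y _; rewrite /= chiD; ring.
Qed.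

Lemma exp_sum_conj s z : (exp_sum s z)^*%C = exp_sum [seq ((x.1)^*%C, - x.2) | x <- s] z.
Proof.
rewrite /exp_sum big_map rmorph_sum; apply: eq_bigr => x _ /=.
by rewrite rmorphM /= chi_conj.
Qed.

Lemma normc_sqrE s z : normc (exp_sum s z) ^+ 2 =
  complex.Re (exp_sum [seq (x.1 * y.1, x.2 + y.2) |
     x <- s, y <- [seq ((x.1)^*%C, - x.2) | x <- s]] z).
Proof. by rewrite -exp_sum_mul -exp_sum_conj -normc_sqr. Qed.

Lemma measurable_normc_exp_sum s : measurable_fun setT (fun z => normc (exp_sum s z)).
Proof. exact/measurable_normc/cmeasurable_exp_sum. Qed.

Lemma chiMn (v : 'rV[int]_n) m z : chi (v *+ m) z = chi v z ^+ m :> R[i].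
Proof. by elim: m => [|m IH]; rewrite ?mulr0n ?chi0 ?expr0// mulrS chiD IH exprS. Qed.

(** The Dirichlet kernel of the character [chi v]. *)
Definition dirichlet (v : 'rV[int]_n) K : seq (R[i] * 'rV[int]_n) :=
  [seq (1, v *+ m) | m : 'I_K <- enum 'I_K].

(** If u is within 1/K of 1, its powers u^m are within m/K of 1, so that the sum
    of the first K of them is within K/2 of K. *)
Lemma dirichlet_ge (v : 'rV[int]_n) K z : (0 < K)%N ->
  normc (chi v z - 1) <= K%:R^-1 -> K%:R / 2 <= normc (exp_sum (dirichlet v K) z).
Proof.
move=> K0 small; have K0' : 0 < K%:R :> R by rewrite ltr0n.
have DE : exp_sum (dirichlet v K) z = \sum_(m < K) chi v z ^+ m.
  by rewrite /exp_sum big_map big_enum; apply: eq_bigr => m _; rewrite mul1r chiMn.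
have dist : normc (K%:R - exp_sum (dirichlet v K) z) <= K%:R / 2.
  rewrite normcB DE -[K in K%:R]card_ord -sumr_const -sumrB.
  apply: le_trans (_ : \sum_(m < K) m%:R / K%:R <= _).
    apply: (big_ind2 (fun x y => normc x <= y)) => [|x1 x2 y1 y2 h1 h2|m _].
    - by rewrite normc0.
    - by apply: le_trans (le_normcD _ _) _; exact: lerD.
    - apply: le_trans (normcX_sub1 m (normc_chi _ _)) _.
      by rewrite ler_wpM2l.
  rewrite -mulr_suml -natr_sum ler_pdivrMr// mulrAC ler_pdivlMr//.
  rewrite -natrM -natrM ler_nat.
  have := bin2_sum K; rewrite big_mkord => ->.
  by rewrite bin2 muln2 halfK (leq_trans (leq_subr _ _))// leq_mul2l leq_pred orbT.
have := le_normcD (K%:R - exp_sum (dirichlet v K) z) (exp_sum (dirichlet v K) z).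
rewrite subrK; have -> : normc (K%:R : R[i]) = K%:R.
  by rewrite -[K%:R]/(1 *+ K) normcMn normc1.
move: dist; lra.
Qed.

(** Parseval: the K exponents [v *+ m] are distinct because [v != 0]. *)
Lemma Rintegral_dirichlet (v : 'rV[int]_n) K : v != 0 ->
  (\int[haar n]_z normc (exp_sum (dirichlet v K) z) ^+ 2)%R = K%:R.
Proof.
move=> /rV0Pn[i vi].
have vM (a b : nat) : (v *+ a - v *+ b == 0) = (a == b).
  apply/idP/eqP => [|->]; last by rewrite subrr.
  rewrite subr_eq0 => /eqP/matrixP/(_ ord0 i); rewrite !mulmxnE.
  by move=> /eqP; rewrite -mulr_natr -[X in _ == X]mulr_natr (inj_eq (mulfI vi)) eqr_nat => /eqP.
under eq_Rintegral do rewrite normc_sqrE.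
rewrite Rintegral_exp_sum big_mkcond big_allpairs_dep /dirichlet big_map big_enum.
rewrite (eq_bigr (fun=> 1)) => [|a _]; last first.
  rewrite 2!big_map big_enum -big_mkcond /= (big_pred1 a) => [|b]; first by rewrite mul1r; exact: conjc1.
  by rewrite /= vM eq_sym -(inj_eq val_inj).
rewrite sumr_const card_ord.
by rewrite raddfMn.
Qed.

Lemma integrable_sqr_normc_exp_sum s :
  (haar n).-integrable setT (fun z => (normc (exp_sum s z) ^+ 2)%:E).
Proof. by under eq_fun do rewrite normc_sqrE; exact: integrable_Re_exp_sum. Qed.

(** Chebyshev's inequality for the squared Dirichlet kernel, which is at least
    K^2/4 on this set and has mean K. *)
Lemma chi_small_ball (v : 'rV[int]_n) K : v != 0 -> (0 < K)%N ->
  (haar n [set h : torus R n | (normc (chi v h - 1) <= K%:R^-1)%R] <= (4 / K%:R)%:E)%E.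
Proof.
move=> v0 K0; have K0' : 0 < K%:R :> R by rewrite ltr0n.
have mD := measurable_normc_exp_sum (dirichlet v K).
pose a : R := (K%:R / 2) ^+ 2.
have a0 : 0 < a by rewrite exprn_gt0// divr_gt0.
have := @le_integral_abse _ _ _ (haar n) setT measurableT
  (fun z => (normc (exp_sum (dirichlet v K) z) ^+ 2)%:E) a _ a0.
rewrite setTI.
have mD2 : measurable_fun setT (fun z : torus R n => (normc (exp_sum (dirichlet v K) z) ^+ 2)%:E).
  by apply/measurable_EFinP; exact: measurable_funX.
move=> /(_ mD2).
under eq_integral do rewrite gee0_abs ?lee_fin ?sqr_ge0//.
rewrite EFin_Rintegral ?Rintegral_dirichlet//; last exact: integrable_sqr_normc_exp_sum.
move=> H.
have -> : (4 / K%:R)%:E = (a^-1%:E * K%:R%:E)%E :> \bar R.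
  rewrite -EFinM; congr (_%:E); rewrite /a; field.
  by rewrite ?lt0r_neq0.
rewrite lee_pdivlMl//; apply: le_trans H; rewrite lee_pmul2l//.
apply: le_measure; rewrite ?inE.
- rewrite (_ : [set h | _] = [set h | normc (exp_sum [:: (1, v); (-1, 0)] h) <= K%:R^-1]).
    apply: (measurable_sublevel _ (measurable_normc_exp_sum _)).
  by apply/seteqP; split => h /=; rewrite !exp_sum_cons exp_sum_nil /= chi0 mul1r mulr1 addr0.
- have : measurable (setT `&` [set x : torus R n | (a%:E <= `|(normc (exp_sum (dirichlet v K) x) ^+ 2)%:E|)%E]).
    by apply: emeasurable_fun_c_infty => //; exact: measurableT_comp.
  by rewrite setTI.
- move=> h /= /(dirichlet_ge K0) Kh.
  by rewrite lee_fin ger0_norm ?sqr_ge0// ler_pXn2r// nnegrE ?normc_ge0 ?divr_ge0 ?ler0n.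
Qed.

End trig_algebra.

(** * Small values of exponential sums *)

Section small_ball.
Context {R : realType}.

Lemma torus_mulC n (w z : torus R n) : torus_mul w z = torus_mul z w.
Proof.
apply/eq_from_tnth => i; rewrite !tnth_mktuple.
by apply/val_inj; rewrite /= mulrC.
Qed.

Lemma measurable_preimage_torus_mul n (w : torus R n) (E : set (torus R n)) :
  measurable E -> measurable (torus_mul w @^-1` E).
Proof.
by move=> mE; rewrite -[X in measurable X]setTI; exact: measurable_torus_mull.
Qed.

(** By Tonelli and invariance, the mean over [h] of the measure of
    E inter h^-1 E is the square of the measure of E.  The set [A] consists of the
    exceptional translations, for which the intersection is not controlled. *)
Lemma haar_self_correlation n (E A : set (torus R n)) (b : R) :
  measurable E -> measurable A -> 0 <= b ->
  (forall h, ~ A h -> (haar n (E `&` torus_mul h @^-1` E) <= b%:E)%E) ->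
  (haar n E * haar n E <= haar n A + b%:E)%E.
Proof.
move=> mE mA b0 Eb.
pose S := [set p : torus R n * torus R n | E p.2 /\ E (torus_mul p.1 p.2)].
have mS : measurable S.
  rewrite (_ : S = (setT `&` snd @^-1` E) `&`
      (setT `&` (fun p : torus R n * torus R n => torus_mul p.1 p.2) @^-1` E)).
    apply: measurableI; first exact: measurable_snd.
    exact: measurable_torus_mul.
  by apply/seteqP; split => p /=; [move=> []|move=> [[]] _ ? []].
have mSi : measurable_fun setT (EFin \o (\1_S : _ -> R)).
  by apply/measurable_EFinP.
have S0 p : (0 <= (EFin \o (\1_S : _ -> R)) p)%E by rewrite lee_fin.
have := fubini_tonelli (m1 := haar n) (m2 := haar n) _ mSi S0.
have sec1 h : (\int[haar n]_z (EFin \o (\1_S : _ -> R)) (h, z) =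
    haar n (E `&` torus_mul h @^-1` E))%E.
  rewrite -[E `&` _]setIT -(integral_indic (haar n) measurableT); last first.
    exact: (measurableI _ _ mE (measurable_preimage_torus_mul _ mE)).
  by apply: eq_integral => z _ /=; rewrite !indicE; congr ((nat_of_bool _)%:R%:E);
     apply/idP/idP; rewrite !inE.
have sec2 z : (\int[haar n]_h (EFin \o (\1_S : _ -> R)) (h, z) =
    haar n E * (\1_E z)%:E)%E.
  rewrite indicE; have [Ez|Ez] := boolP (z \in E).
    rewrite mule1 -(haar_translation z)// -[torus_mul z @^-1` E]setIT -(integral_indic (haar n) measurableT); last first.
      exact: (measurable_preimage_torus_mul _ mE).
    apply: eq_integral => h _ /=; rewrite !indicE; congr ((nat_of_bool _)%:R%:E).
    apply/idP/idP; rewrite !inE /S /= torus_mulC; first by case.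
    by move=> ?; split => //; rewrite -inE.
  rewrite mule0 -[RHS](integral0 (haar n) setT); apply: eq_integral => h _ /=.
  rewrite indicE (_ : _ \in S = false)//; apply/negbTE.
  by apply: contra Ez; rewrite !inE => -[].
under eq_integral do rewrite sec1.
under [in X in _ = X -> _]eq_integral do rewrite sec2.
rewrite ge0_integralZl//; last exact/measurable_EFinP.
rewrite integral_indic// setIT => <-.
apply: le_trans (_ : \int[haar n]_h ((\1_A h)%:E + b%:E) <= _)%E.
  apply: ge0_le_integral => //.
  - have := measurable_fun_fubini_tonelli_F (m2 := haar n) _ mSi S0.
    by apply: eq_measurable_fun => h _; rewrite /fubini_F sec1.
  - by apply: emeasurable_funD; [exact/measurable_EFinP|exact: measurable_cst].
  - move=> h _; rewrite indicE; have [Ah|Ah] := boolP (h \in A).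
      apply: le_trans (_ : 1 <= _)%E; last by rewrite leeDl// lee_fin.
      apply: probability_le1.
      exact: (measurableI _ _ mE (measurable_preimage_torus_mul _ mE)).
    by rewrite add0e; apply: Eb => /mem_set; exact/negP.
rewrite ge0_integralD//; last exact/measurable_EFinP.
by rewrite integral_indic// setIT integral_cst// [X in (_ + _ * X)%E](probability_setT (haar n)) mule1.
Qed.

(** For [u = chi e h], the terms with exponent [e] disappear. *)
Lemma exp_sum_difference n (s : seq (R[i] * 'rV[int]_n)) (u : R[i]) (h z : torus R n) :
  exp_sum s (torus_mul h z) - u * exp_sum s z =
  exp_sum [seq (x.1 * (chi x.2 h - u), x.2) | x <- s] z.
Proof.
rewrite /exp_sum mulr_sumr -sumrB big_map; apply: eq_bigr => x _ /=.
by rewrite chi_torus_mul; ring.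
Qed.

Lemma measurable_small n (s : seq (R[i] * 'rV[int]_n)) (a : R) :
  measurable [set z : torus R n | normc (exp_sum s z) <= a].
Proof. exact: (measurable_sublevel _ (measurable_normc_exp_sum s)). Qed.

(** Induction on the number of terms, by self-correlation of the set [E] where
    the sum is small: for [z] and [hz] in [E], the difference of
    [exp_sum_difference] is a small value of a sum with one term fewer, whose head
    coefficient is [c0 * (chi e0 h - chi e1 h)].  The term [c0] is kept at the
    head and never eliminated; only its exponent has to differ from the others.

    The exponent [4 ^ k] leaves room for the loss 2^(-2 4^k j) in the head
    coefficient and for applying the induction hypothesis at scale 2j - 1.  The
    constant 4 reproduces itself, as 4 * 4^-j + 4 * 2^-(2j-1) = 12 * 4^-j is at
    most (4 * 2^-j)^2. *)
Lemma small_ball k n (c0 : R[i]) (e0 : 'rV[int]_n) s j : size s = k ->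
  all (fun x => x.2 != e0) s -> c0 != 0 ->
  (haar n [set z : torus R n |
     (normc (exp_sum ((c0, e0) :: s) z) <= normc c0 * 2^-1 ^+ (4 ^ k * j))%R]
   <= (4 * 2^-1 ^+ j)%:E)%E.
Proof.
have triv (A : set (torus R n)) : measurable A -> (haar n A <= (4 * 2^-1 ^+ 0)%:E)%E.
  move=> mA; apply: le_trans (probability_le1 _ mA) _.
  by rewrite lee_fin expr0 mulr1 ler1n.
elim: k c0 s j => [|k IH] c0 s j sk se0 c00.
  case: j => [|i]; first exact: (triv _ (measurable_small _ _)).
  rewrite (size0nil sk) expn0 mul1n (_ : [set z | _] = set0).
    by rewrite measure0 lee_fin mulr_ge0// exprn_ge0// invr_ge0.
  apply/seteqP; split => z //=; rewrite exp_sum1 normcM normc_chi mulr1.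
  apply/negP; rewrite -ltNge gtr_pMr ?normc_gt0//.
  by rewrite exprn_ilt1// ?invr_ge0// invf_lt1// ltr1n.
case: j => [|i]; first exact: (triv _ (measurable_small _ _)).
case: s sk se0 => //= -[c1 e1] s /= [sk] /andP[e10 se0].
set E := [set z | _].
have mE : measurable E by exact: measurable_small.
pose v := e0 - e1.
have v0 : v != 0 by rewrite subr_eq0 eq_sym.
pose K := (2 ^ (2 * 4 ^ k * i.+1))%N.
have K0 : (0 < K)%N by rewrite expn_gt0.
pose A := [set h : torus R n | normc (chi v h - 1) <= K%:R^-1].
have chiv (h : torus R n) : normc (chi v h - 1) = normc (chi e0 h - chi e1 h).
  rewrite -[LHS]mulr1 -(normc_chi e1 h) -normcM mulrBl mul1r -chiD.
  by rewrite /v subrK.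
have mA : measurable A.
  rewrite (_ : A = [set h | normc (exp_sum [:: (1, v); (-1, 0)] h) <= K%:R^-1]).
    exact: measurable_small.
  by apply/seteqP; split => h; rewrite /A /= !exp_sum_cons exp_sum_nil /= chi0 mul1r mulr1 addr0.
have KE : K%:R^-1 = 2^-1 ^+ (2 * 4 ^ k * i.+1) :> R by rewrite natrX exprVn.
have half0 : 0 < 2^-1 :> R by rewrite invr_gt0.
have half1 : 2^-1 <= 1 :> R by rewrite invf_le1// ler1n.
have corr h : ~ A h ->
    (haar n (E `&` torus_mul h @^-1` E) <= (4 * 2^-1 ^+ (2 * i).+1)%:E)%E.
  move=> /negP; rewrite -ltNge chiv KE => Ah.
  pose u := chi e1 h.
  pose s' := [seq (x.1 * (chi x.2 h - u), x.2) | x <- s].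
  have ss' : size s' = k by rewrite size_map.
  have s'e0 : all (fun x => x.2 != e0) s' by rewrite all_map.
  have c0' : c0 * (chi e0 h - u) != 0.
    rewrite mulf_neq0//; apply/eqP => uu; move: Ah; rewrite uu normc0.
    by apply/negP; rewrite -leNgt exprn_ge0// ltW.
  apply: le_trans (IH _ s' _ ss' s'e0 c0').
  apply: le_measure; rewrite ?inE; [|exact: measurable_small|].
    exact: (measurableI _ _ mE (measurable_preimage_torus_mul _ mE)).
  move=> z [Ez Ehz] /=.
  (* The zero term contributed by (c1, e1) is what the choice of u is for. *)
  have -> : exp_sum ((c0 * (chi e0 h - u), e0) :: s') z =
      exp_sum [:: (c0, e0), (c1, e1) & s] (torus_mul h z) -
      u * exp_sum [:: (c0, e0), (c1, e1) & s] z.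
    by rewrite exp_sum_difference /= !exp_sum_cons /= /u subrr mulr0 mul0r add0r.
  apply: le_trans (le_normcD _ _) _.
  rewrite normcN normcM normc_chi mul1r.
  apply: le_trans (lerD Ehz Ez) _.
  rewrite normcM -mulrDr -mulrA ler_pM2l ?normc_gt0//.
  apply: le_trans (ler_wpM2r _ (ltW Ah)); last by rewrite exprn_ge0// ltW.
  rewrite -exprD -mulr2n.
  have k1 : (0 < 4 ^ k)%N by rewrite expn_gt0.
  (* The spare 4 ^ k >= 1 in the exponent absorbs the factor 2 of |f(hz)| + |f(z)|. *)
  have -> : (4 ^ k.+1 * i.+1 = (2 * 4 ^ k * i.+1 + 4 ^ k * (2 * i).+1) + 4 ^ k)%N.
    by rewrite expnS; nia.
  rewrite [in leLHS](exprD _ (_ + _)%N) -[leLHS]mulr_natl mulrCA.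
  apply: ler_piMr; first by rewrite exprn_ge0// ltW.
  rewrite -(prednK k1) exprS mulrA mulfV// mul1r.
  by apply: exprn_ile1 => //; exact: ltW.
have b0 : 0 <= 4 * 2^-1 ^+ (2 * i).+1 :> R by rewrite mulr_ge0// exprn_ge0// ltW.
have := haar_self_correlation mE mA b0 corr.
have := chi_small_ball (R := R) v0 K0; rewrite -/A KE.
have /fineK <- : haar n E \is a fin_num by exact: fin_num_measure.
have /fineK <- : haar n A \is a fin_num by exact: fin_num_measure.
rewrite -EFinM -EFinD !lee_fin => hA hE.
have : fine (haar n E) ^+ 2 <= (4 * 2^-1 ^+ i.+1) ^+ 2.
  rewrite expr2; apply: le_trans hE _; apply: le_trans (lerD hA (lexx _)) _.
  have k1 : (0 < 4 ^ k)%N by rewrite expn_gt0.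
  have : 2^-1 ^+ (2 * 4 ^ k * i.+1) <= 2^-1 ^+ (2 * i.+1) :> R.
    by apply: ler_wiXn2l; rewrite ?(ltW half0)//; nia.
  have -> : 2^-1 ^+ (2 * i).+1 = 2 * 2^-1 ^+ (2 * i.+1) :> R.
    by rewrite mulnS add2n [in RHS]exprS mulrA mulfV// mul1r.
  rewrite exprMn -exprM [(i.+1 * 2)%N]mulnC.
  have : 0 <= 2^-1 ^+ (2 * i.+1) :> R by rewrite exprn_ge0// ltW.
  lra.
by rewrite ler_pXn2r// nnegrE ?fine_ge0// mulr_ge0// exprn_ge0// ltW.
Qed.

End small_ball.

(** * Moments from exponential tails *)

Section tail_moment.
Context {R : realType}.

(** From y^p <= p! l^-p exp(l y), with [l] chosen so that exp(l a) = 3/2: the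
    ratio 3/2 grows slower than the ratio 2 at which the tails below decay. *)
Lemma pow_le_geometric (A a : R) p : 0 <= A -> 0 < a ->
  exists2 D : R, 0 <= D & forall j, (A + a * j%:R) ^+ p <= D * (3 / 2) ^+ j.
Proof.
move=> A0 a0.
have l0 : 0 < ln (3 / 2) :> R by apply: ln_gt0; lra.
pose l := ln (3 / 2) / a; have ll : 0 < l by rewrite divr_gt0.
pose D := p`!%:R / l ^+ p * expR (l * A).
exists D; first by rewrite mulr_ge0 ?expR_ge0// divr_ge0// exprn_ge0// ltW.
move=> j; have y0 : 0 <= A + a * j%:R by rewrite addr_ge0// mulr_ge0// ltW.
have expE : expR (l * (A + a * j%:R)) = expR (l * A) * (3 / 2) ^+ j.
  rewrite mulrDr expRD mulrA /l divfK ?lt0r_neq0// expRM_natr lnK//.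
  by rewrite posrE; lra.
have -> : D * (3 / 2) ^+ j = p`!%:R / l ^+ p * expR (l * (A + a * j%:R)).
  by rewrite expE mulrA.
rewrite mulrAC ler_pdivlMr ?exprn_gt0// mulrC -exprMn.
case: p {D} => [|p].
  rewrite expr0 fact0 mul1r.
  by rewrite -[leLHS]expR0 ler_expR mulr_ge0// ltW.
have : 0 <= l * (A + a * j%:R) by rewrite mulr_ge0// ltW.
move=> /(expR_ge1Dxn p); rewrite -ler_pdivrMl ?ltr0n ?fact_gt0//.
by apply: le_trans; rewrite mulrC lerDr.
Qed.

Lemma nneseries_geometric_le (D : R) : 0 <= D ->
  (\sum_(0 <= j <oo) (D * (3 / 4) ^+ j)%:E <= (4 * D)%:E)%E.
Proof.
move=> D0; apply: lime_le.
  by apply: is_cvg_nneseries => j _ _; rewrite lee_fin mulr_ge0// exprn_ge0//; lra.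
apply: nearW => k; rewrite sumEFin lee_fin.
suff -> : \sum_(0 <= j < k) D * (3 / 4) ^+ j = 4 * D * (1 - (3 / 4) ^+ k).
  rewrite ler_piMr ?mulr_ge0// gerBl exprn_ge0//; lra.
elim: k => [|k IH]; first by rewrite big_geq// expr0 subrr mulr0.
by rewrite big_nat_recr//= IH exprS; field.
Qed.

(** The function (c + Y)^p is dominated by (c + b)^p plus the sum over j of
    D (3/2)^j on the event Y >= a j + b, whose integral is a geometric series of
    ratio 3/4.  The bound [K] is chosen before the probability space, so that it
    can serve all the homomorphisms [monomial_map A] at once. *)
Lemma exponential_tail_moment (a b c : R) p : 0 < a -> 0 <= b -> 0 <= c ->
  exists2 K : R, 0 <= K & forall d (T : measurableType d) (mu : probability T R)
    (Y : T -> R), measurable_fun setT Y -> (forall x, 0 <= Y x) ->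
    (forall j, mu [set x | (a * j%:R + b <= Y x)%R] <= (4 * 2^-1 ^+ j)%:E)%E ->
    (\int[mu]_x ((c + Y x) ^+ p)%:E <= K%:E)%E.
Proof.
move=> a0 b0 c0; have A0 : 0 <= c + b + a by rewrite !addr_ge0// ltW.
have [D D0 HD] := pow_le_geometric p A0 a0.
exists ((c + b) ^+ p + 4 * (4 * D)).
  by rewrite addr_ge0 ?exprn_ge0 ?addr_ge0 ?mulr_ge0.
move=> d T mu Y mY Y0 tail.
pose E j := [set x | a * j%:R + b <= Y x].
have mE j : measurable (E j) by exact: measurable_superlevel.
pose g j x := ((D * (3 / 2) ^+ j)%:E * (\1_(E j) x)%:E)%E.
have w0 j : 0 <= D * (3 / 2) ^+ j by rewrite mulr_ge0// exprn_ge0//; lra.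
have g0 j x : (0 <= g j x)%E by rewrite mule_ge0// lee_fin.
have mg j : measurable_fun setT (g j).
  by apply: measurable_funeM; exact/measurable_EFinP.
have mS : measurable_fun setT (fun x => \sum_(0 <= j <oo) g j x)%E.
  by apply: ge0_emeasurable_sum => // j x _ _; exact: g0.
apply: le_trans (_ : \int[mu]_x (((c + b) ^+ p)%:E + \sum_(0 <= j <oo) g j x) <= _)%E.
  apply: ge0_le_integral => //.
  - by move=> x _; rewrite lee_fin exprn_ge0// addr_ge0.
  - apply/measurable_EFinP/measurable_funX/measurable_funD => //.
  - by apply: emeasurable_funD => //.
  - move=> x _; have [Yb|bY] := ltP (Y x) b.
      apply: le_trans (_ : ((c + b) ^+ p)%:E <= _)%E.
        rewrite lee_fin; apply: lerXn2r; rewrite ?nnegrE ?addr_ge0//.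
        by rewrite lerD2l ltW.
      by rewrite leeDl// nneseries_ge0.
    have : 0 <= (Y x - b) / a by rewrite divr_ge0 ?subr_ge0// ltW.
    move=> /truncn_itv; set j := Num.truncn _ => /andP[].
    rewrite ler_pdivlMr// ltr_pdivrMr// => jY Yj.
    have Ej : E j x by rewrite /E /=; move: jY; lra.
    (* The j-th term alone dominates, as Y < a (j + 1) + b. *)
    apply: le_trans (_ : g j x <= _)%E.
      rewrite /g indicE mem_set// mule1 lee_fin; apply: le_trans (HD j).
      apply: lerXn2r; rewrite ?nnegrE.
      - by rewrite addr_ge0.
      - by rewrite addr_ge0// mulr_ge0// ltW.
      - by move: Yj; rewrite -natr1 mulrDl mul1r [_ * a]mulrC; lra.
    apply: le_trans (leeDr _ _); last by rewrite lee_fin exprn_ge0// addr_ge0.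
    apply: le_trans (nneseries_lim_ge j.+1 _) => //.
    by rewrite big_nat_recr//= leeDr// sume_ge0.
rewrite ge0_integralD//; last 2 first.
- by move=> x _; rewrite lee_fin exprn_ge0// addr_ge0.
- by move=> x _; exact: nneseries_ge0.
rewrite integral_cst// [X in (_ * X + _)%E](probability_setT mu) mule1 EFinD leeD2l//.
rewrite integral_nneseries//.
apply: le_trans (nneseries_geometric_le _); last by rewrite mulr_ge0.
apply: lee_nneseries => [j _ _|j _]; first exact: integral_ge0.
rewrite /g ge0_integralZl//; [|exact/measurable_EFinP|by rewrite lee_fin].
rewrite integral_indic// setIT.
apply: (le_trans (lee_wpmul2l _ (tail j))); first by rewrite lee_fin.
rewrite -EFinM lee_fin.
have -> : (3 / 4) ^+ j = (3 / 2) ^+ j * 2^-1 ^+ j :> R.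
  by rewrite -exprMn; congr (_ ^+ j); field.
by rewrite le_eqVlt; apply/orP; left; apply/eqP; ring.
Qed.

End tail_moment.

(** * Moments of logarithms of Laurent polynomials *)

Section log_moments.
Context {R : realType}.

Lemma boyd_height_neq0 n m (A : 'M[int]_(n, m)) (B : nat) (v : 'rV[int]_n) :
  ((B.+1)%:R%:E <= boyd_height A :> \bar R)%E -> v != 0 -> (sup_norm v <= B)%N ->
  v *m A != 0.
Proof.
move=> BA v0 vB; apply/eqP => vA.
have : (boyd_height A <= (sup_norm v)%:R%:E :> \bar R)%E.
  by apply: ereal_inf_lbound; exists v.
move=> /(le_trans BA); rewrite lee_fin ler_nat => /leq_trans/(_ vB).
by rewrite ltnn.
Qed.

(** Finitely many nonzero exponents are not annihilated by a matrix of large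
    height; the bound is uniform in the dimension of the source torus. *)
Lemma large_height_neq0 n (s : seq 'rV[int]_n) : exists B : R,
  forall m (A : 'M[int]_(n, m)), (B%:E <= boyd_height A)%E ->
  forall v, v \in s -> v != 0 -> v *m A != 0.
Proof.
exists ((\max_(v <- s) sup_norm v).+1%:R) => m A BA v vs v0.
apply: boyd_height_neq0 BA v0 _.
exact: (@leq_bigmax_seq _ _ xpredT (@sup_norm n)).
Qed.

Lemma boyd_height1 n : boyd_height (1%:M : 'M[int]_n) = +oo%E :> \bar R.
Proof. by apply: boyd_height_pinfty => v; rewrite mulmx1. Qed.

Lemma monomial_map1 n (z : torus R n) : monomial_map 1%:M z = z.
Proof.
apply/eq_from_tnth => i; rewrite tnth_mktuple; apply/val_inj => /=.
rewrite (bigD1 i)//= big1 => [|j /negbTE ji]; first by rewrite mxE eqxx mulr1 expr1z.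
by rewrite mxE eq_sym ji expr0z.
Qed.

Definition subst_terms n m (A : 'M[int]_(n, m)) (s : seq (R[i] * 'rV[int]_n)) :=
  [seq (x.1, x.2 *m A) | x <- s].

Lemma exp_sum_monomial_map n m (A : 'M[int]_(n, m)) s (z : torus R m) :
  exp_sum s (monomial_map A z) = exp_sum (subst_terms A s) z.
Proof.
by rewrite /exp_sum big_map; apply: eq_bigr => x _; rewrite chi_monomial_map.
Qed.

Definition laurent_terms n (P : laurent R n) := [seq (P e, e) | e <- finsupp P].

Lemma laurent_evalE n (P : laurent R n) z : laurent_eval P z = exp_sum (laurent_terms P) z.
Proof. by rewrite /exp_sum big_map. Qed.

(** As [ln 0 = 0], this vanishes at the zeros of [P], a null set when [P] is
    nonzero. *)
Definition abs_log n (P : laurent R n) (z : torus R n) : R :=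
  `|ln (normc (laurent_eval P z))|.

Lemma measurable_laurent n m (A : 'M[int]_(n, m)) (P : laurent R n) :
  measurable_fun setT (fun z : torus R m => normc (laurent_eval P (monomial_map A z))).
Proof.
under eq_fun do rewrite laurent_evalE exp_sum_monomial_map.
exact: measurable_normc_exp_sum.
Qed.

Lemma measurable_normc_laurent n (P : laurent R n) :
  measurable_fun setT (fun z : torus R n => normc (laurent_eval P z)).
Proof. by under eq_fun do rewrite laurent_evalE; exact: measurable_normc_exp_sum. Qed.

Lemma le0_geometric (p : R) : (forall j, p <= 4 * 2^-1 ^+ j) -> p <= 0.
Proof.
move=> H; rewrite leNgt; apply/negP => p0.
have := H (Num.truncn (4 / p)).+1; apply/negP; rewrite -ltNge.
have q0 : 0 <= 4 / p by rewrite divr_ge0// ltW.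
rewrite exprVn ltr_pdivrMr ?exprn_gt0// mulrC -ltr_pdivrMr//.
have /andP[_ /lt_le_trans] := truncn_itv q0; apply.
by rewrite -natrX ler_nat ltnW// ltn_expl.
Qed.

(** Isolates a nonzero coefficient, to be used as the head term in
    [small_ball]. *)
Lemma laurent_head n (P : laurent R n) : P != [fsfun] ->
  exists2 e0, P e0 != 0 &
  forall z, laurent_eval P z =
    exp_sum ((P e0, e0) :: [seq (P e, e) | e <- finsupp P & e != e0]) z.
Proof.
move=> P0; have [e0 Pe0] : exists e0, P e0 != 0.
  apply: contrapT => H; move/eqP: P0; apply; apply/fsfunP => e.
  by rewrite fsfun0E; apply: contrapT => /eqP Pe; apply: H; exists e.
exists e0 => // z; rewrite laurent_evalE exp_sum_cons /exp_sum !big_map.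
by rewrite (bigD1_seq e0) ?fset_uniq ?mem_finsupp//= big_filter.
Qed.

Lemma laurent_bound n k (P : 'I_k -> laurent R n) : exists2 M : R, 0 < M &
  forall i z, normc (laurent_eval (P i) z) <= M.
Proof.
exists (1 + \sum_i \sum_(x <- laurent_terms (P i)) normc x.1).
  rewrite ltr_pwDl// sumr_ge0// => i _; apply: sumr_ge0 => x _; exact: normc_ge0.
move=> i z; rewrite laurent_evalE; apply: le_trans (normc_exp_sum _ _) _.
rewrite (bigD1 i)//= addrCA lerDl addr_ge0// sumr_ge0// => j _.
by apply: sumr_ge0 => x _; exact: normc_ge0.
Qed.

(** When [A] annihilates no difference between the head exponent and another
    exponent of [P], the substituted sum still has a head exponent distinct from
    the others, with the same head coefficient and the same number of terms.  These are the only data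
    on which [small_ball] depends, whence bounds that do not depend on [m] and
    [A]. *)
Lemma log_moment n (P : laurent R n) : P != [fsfun] ->
  exists B : R,
  (forall m (A : 'M[int]_(n, m)), (B%:E <= boyd_height A)%E ->
     (haar m).-negligible [set z | laurent_eval P (monomial_map A z) = 0]) /\
  (forall c p, 0 <= c -> exists2 K : R, 0 <= K &
     forall m (A : 'M[int]_(n, m)), (B%:E <= boyd_height A)%E ->
     (\int[haar m]_z ((c + abs_log P (monomial_map A z)) ^+ p)%:E <= K%:E)%E).
Proof.
move=> /laurent_head[e0 c00 PE].
set s := map _ _ in PE; set c0 := P e0 in PE c00.
have [B HB] := large_height_neq0 [seq e - e0 | e <- finsupp P].
have sb m (A : 'M[int]_(n, m)) j : (B%:E <= boyd_height A)%E ->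
    (haar m [set z | (normc (laurent_eval P (monomial_map A z)) <=
       normc c0 * 2^-1 ^+ (4 ^ size s * j))%R] <= (4 * 2^-1 ^+ j)%:E)%E.
  move=> BA.
  under eq_set do rewrite PE exp_sum_monomial_map.
  apply: small_ball => //; first by rewrite size_map.
  apply/allP => _ /mapP[_ /mapP[e + ->] ->] /=.
  rewrite mem_filter => /andP[ee0 eP].
  rewrite -subr_eq0 -mulmxBl; apply: (HB _ A BA); last by rewrite subr_eq0.
  by apply/mapP; exists e.
(* The zero set is contained in the small-value set at every scale j. *)
exists B; split => [m A BA|c p cge0].
  exists [set z | normc (laurent_eval P (monomial_map A z)) <= 0]; split.
  - exact: (measurable_sublevel _ (measurable_laurent A P)).
  - apply/eqP; rewrite eq_le measure_ge0 andbT.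
    set Z := [set z | _].
    have mZ : measurable Z by exact: (measurable_sublevel _ (measurable_laurent A P)).
    have fZ : haar m Z \is a fin_num by exact: fin_num_measure.
    rewrite -(fineK fZ) lee_fin; apply: le0_geometric => j.
    rewrite -lee_fin fineK//; apply: le_trans (sb _ A j BA).
    apply: le_measure; rewrite ?inE//.
      exact: (measurable_sublevel _ (measurable_laurent A P)).
    move=> z /= /le_trans; apply.
    by rewrite mulr_ge0 ?normc_ge0// exprn_ge0// invr_ge0.
  - by move=> z /= ->; rewrite normc0.
pose a : R := (4 ^ size s)%:R * ln 2.
have ln2 : 0 < ln 2 :> R by rewrite ln_gt0// ltr1n.
have a0 : 0 < a by rewrite mulr_gt0// ltr0n expn_gt0.
pose M := \sum_(x <- laurent_terms P) normc x.1.
(* As |P| <= M, the summand 1 ensures that |ln|P|| >= b forces ln|P| < 0. *)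
pose b := 1 + `|ln M| + `|ln (normc c0)|.
have b0 : 0 <= b by rewrite !addr_ge0.
have [K K0 HK] := exponential_tail_moment p a0 b0 cge0.
exists K => // m A BA.
have mY : measurable_fun setT (fun z : torus R m => abs_log P (monomial_map A z)).
  have mln := measurableT_comp (@measurable_ln R) (measurable_laurent A P).
  exact: (measurableT_comp (@normr_measurable R setT) mln).
apply: HK => [|z|j].
- exact: mY.
- exact: normr_ge0.
apply: le_trans (sb _ A j BA); apply: le_measure; rewrite ?inE.
- exact: measurable_superlevel.
- exact: (measurable_sublevel _ (measurable_laurent A P)).
move=> z /=; rewrite /abs_log; set f := normc _.
have : 0 <= f by exact: normc_ge0.
rewrite le_eqVlt => /predU1P[<-|f0].
  by move=> _; rewrite mulr_ge0 ?normc_ge0// exprn_ge0// invr_ge0.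
have fM : f <= M by rewrite /f laurent_evalE; exact: normc_exp_sum.
have lfM : ln f <= `|ln M|.
  by apply: le_trans (ler_norm _); rewrite ler_ln// posrE// (lt_le_trans f0).
move=> large.
have lf0 : ln f < 0.
  rewrite ltNge; apply/negP => lf0; move: large; rewrite ger0_norm// /b.
  have := normr_ge0 (ln (normc c0)).
  have : 0 <= a * j%:R by rewrite mulr_ge0// ltW.
  move: lfM; lra.
have t0 : 0 < normc c0 * 2^-1 ^+ (4 ^ size s * j) :> R.
  by rewrite mulr_gt0 ?normc_gt0// exprn_gt0// invr_gt0.
rewrite -ler_ln ?posrE// lnM ?posrE ?normc_gt0 ?exprn_gt0 ?invr_gt0//.
rewrite lnXn ?invr_gt0// lnV ?posrE// -[_ *+ (_ * _)]mulr_natl natrM.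
move: large; rewrite ltr0_norm// /b /a.
have : - `|ln (normc c0)| <= ln (normc c0) by rewrite lerNl -normrN ler_norm.
have := normr_ge0 (ln M).
move: (ln (normc c0)) (ln M) (ln f) (ln 2) (4 ^ size s)%:R (j%:R : R); clear.
by move=> *; lra.
Qed.

End log_moments.

(** * Polynomial approximation of the logarithm *)

Section log_approximation.
Context {R : realType}.

Definition log_taylor N : {poly R} := - \sum_(j < N) j.+1%:R^-1 *: (1 - 'X) ^+ j.+1.

Lemma log_taylorE N x : (log_taylor N).[x] = - \sum_(j < N) (1 - x) ^+ j.+1 / j.+1%:R.
Proof.
rewrite hornerN horner_sum; congr (- _); apply: eq_bigr => j _.
by rewrite hornerZ horner_exp hornerD hornerN hornerC hornerX mulrC.
Qed.

Lemma log_taylor_deriv N x : x != 0 ->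
  (log_taylor N)^`().[x] - x^-1 = - ((1 - x) ^+ N / x).
Proof.
move=> x0; have -> : (log_taylor N)^`() = \sum_(j < N) (1 - 'X) ^+ j.
  rewrite /log_taylor derivN raddf_sum -sumrN; apply: eq_bigr => j _ /=.
  rewrite derivZ deriv_exp.
  have -> : (1 - 'X : {poly R})^`() = - 1 by rewrite derivB derivX -polyC1 derivC sub0r.
  rewrite /= mulN1r mulNrn scalerN opprK -[_ ^+ _ *+ _]scaler_nat scalerA mulVf ?scale1r//.
have geo : x * (\sum_(j < N) (1 - 'X) ^+ j).[x] = 1 - (1 - x) ^+ N.
  elim: N => [|N IH]; first by rewrite big_ord0 horner0 mulr0 expr0 subrr.
  rewrite big_ord_recr hornerD mulrDr IH horner_exp hornerD hornerN hornerC hornerX exprS.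
  by ring.
apply: (mulfI x0); rewrite mulrBr geo mulfV// mulrN mulrCA mulfV//; ring.
Qed.

(** The difference vanishes at 1 and has derivative -(1 - x)^N / x: the mean value
    theorem on [x, 1] gives both bounds. *)
Lemma log_taylor_bounds N x : 0 < x <= 1 ->
  ln x <= (log_taylor N).[x] <= 0 /\ (log_taylor N).[x] - ln x <= (1 - x) ^+ N / x.
Proof.
move=> /andP[x0 x1].
pose f : R -> R := horner (log_taylor N) - @ln R.
pose df y := (log_taylor N)^`().[y] - y^-1.
have fdf (y : R) : 0 < y -> is_derive y 1 f (df y).
  by move=> y0; apply: is_deriveB; exact: is_derive1_ln.
have [||c] := @MVT_segment R f df x 1 x1.
- by move=> y; rewrite in_itv /= => /andP[xy _]; apply: fdf; exact: lt_trans xy.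
- apply: derivable_within_continuous => y; rewrite in_itv /= => /andP[xy _].
  by apply: ex_derive; apply: fdf; exact: lt_le_trans xy.
rewrite in_itv /= => /andP[xc c1].
have c0 : 0 < c by exact: lt_le_trans xc.
have fE (y : R) : f y = (log_taylor N).[y] - ln y by [].
rewrite /df log_taylor_deriv ?lt0r_neq0// !fE ln1 subr0 log_taylorE big1 => [|j _]; last first.
  by rewrite subrr expr0n mul0r.
rewrite oppr0 sub0r => hE.
have h0 : 0 <= (1 - c) ^+ N / c by rewrite divr_ge0 ?exprn_ge0 ?subr_ge0// ltW.
have hu : (1 - c) ^+ N / c <= (1 - x) ^+ N / x.
  apply: ler_pM; rewrite ?exprn_ge0 ?subr_ge0 ?invr_ge0 ?(ltW c0)//.
    by apply: lerXn2r; rewrite ?nnegrE ?subr_ge0// lerD2l lerN2.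
  by rewrite lef_pV2.
have T0 : (log_taylor N).[x] <= 0.
  rewrite log_taylorE oppr_le0 sumr_ge0// => j _.
  by rewrite divr_ge0// exprn_ge0// subr_ge0.
split; last by nra.
by rewrite T0 andbT; nra.
Qed.

(** No polynomial is uniformly close to [ln] near 0, whence the weight.  For
    x <= eta = exp(-1/eps) one has |ln x| <= eps |ln x|^2, so that the trivial
    bound |ln x| on the error is enough; on [eta, 1] the Taylor polynomials
    converge uniformly. *)
Lemma log_poly_approx (eps : R) : 0 < eps ->
  exists p : {poly R}, forall x, 0 < x <= 1 ->
    `|p.[x]| <= `|ln x| /\ `|ln x - p.[x]| <= eps * (1 + `|ln x|) ^+ 2.
Proof.
move=> e0.
pose eta := expR (- eps^-1); have eta0 : 0 < eta by exact: expR_gt0.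
have eta1 : eta < 1 by rewrite -expR0 ltr_expR oppr_lt0 invr_gt0.
have [N HN] : exists N, (1 - eta) ^+ N / eta <= eps.
  have : (fun N => (1 - eta) ^+ N) @ \oo --> (0 : R).
    by apply: cvg_expr; rewrite ger0_norm; lra.
  move=> /cvgrPdist_le /(_ (eps * eta)) /(_ (mulr_gt0 e0 eta0)) [N _ HN].
  exists N; rewrite ler_pdivrMr//; apply: le_trans (HN N (leqnn N)).
  by rewrite sub0r normrN ler_norm.
exists (log_taylor N) => x x01; have /andP[x0 x1] := x01.
have [/andP[lp p0] up] := log_taylor_bounds N x01.
have l0 : ln x <= 0 by exact: ln_le0.
rewrite (ler0_norm p0) (ler0_norm l0) ler0_norm ?subr_le0//; split; first by rewrite lerN2.
rewrite opprB; have [xe|ex] := leP x eta.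
  have : ln x <= - eps^-1 by rewrite -[leRHS]expRK ler_ln ?posrE.
  set l := ln x in l0 lp up *; set q := _.[x] in p0 lp up *.
  move=> le; have : eps * eps^-1 <= eps * - l by rewrite ler_pM2l// lerNr.
  rewrite mulfV ?lt0r_neq0// => el.
  apply: le_trans (_ : - l <= _); first lra.
  have : 0 <= eps * (1 - l) by rewrite mulr_ge0//; lra.
  have : - l <= eps * (- l) ^+ 2 by rewrite expr2 mulrA ler_peMl; lra.
  rewrite !expr2; nra.
apply: le_trans up _; apply: le_trans (_ : eps <= _).
  apply: le_trans HN; apply: ler_pM => //.
  - by rewrite exprn_ge0// subr_ge0.
  - by rewrite invr_ge0 ltW.
  - by apply: lerXn2r; rewrite ?nnegrE; lra.
  - by rewrite lef_pV2 ?posrE// ltW.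
apply: ler_peMr; first exact: ltW.
by apply: exprn_ege1; move: l0; lra.
Qed.

(** Scaling by an upper bound [M] of the moduli brings them into ]0, 1], where the
    approximation of [ln] is available. *)
Lemma ln_normalized (f M : R) : 0 < f -> f <= M ->
  [/\ 0 < f ^+ 2 / M ^+ 2 <= 1, ln f = ln M + 2^-1 * ln (f ^+ 2 / M ^+ 2) &
   `|ln (f ^+ 2 / M ^+ 2)| <= 2 * `|ln f| + 2 * `|ln M|].
Proof.
move=> f0 fM; have M0 : 0 < M by exact: lt_le_trans fM.
have lE : ln (f ^+ 2 / M ^+ 2) = 2 * ln f - 2 * ln M.
  by rewrite ln_div ?posrE ?exprn_gt0// !lnXn// !mulr_natl.
split.
- rewrite divr_gt0 ?exprn_gt0//= ler_pdivrMr ?exprn_gt0// mul1r.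
  by rewrite ler_pXn2r ?nnegrE ?(ltW f0) ?(ltW M0).
- by rewrite lE; field.
- rewrite lE; apply: le_trans (ler_normB _ _) _.
  by rewrite !normrM ger0_norm.
Qed.

End log_approximation.

(** * Trigonometric polynomials *)

Section trigonometric_polynomials.
Context {R : realType} (n : nat).
Implicit Types F G : torus R n -> R.

Definition trigonometric F := exists t, forall z, (F z)%:C = exp_sum t z.

Lemma trigonometric_cst (c : R) : trigonometric (fun=> c).
Proof. by exists [:: (c%:C, 0)] => z; rewrite exp_sum1 chi0 mulr1. Qed.

Lemma trigonometricD F G : trigonometric F -> trigonometric G ->
  trigonometric (fun z => F z + G z).
Proof.
move=> [s Fs] [t Gt]; exists (s ++ t) => z.
by rewrite /exp_sum big_cat /= -/(exp_sum s z) -/(exp_sum t z) -Fs -Gt rmorphD.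
Qed.

Lemma trigonometricM F G : trigonometric F -> trigonometric G ->
  trigonometric (fun z => F z * G z).
Proof.
move=> [s Fs] [t Gt]; eexists => z.
by rewrite rmorphM /= Fs Gt exp_sum_mul.
Qed.

Lemma trigonometric_sum (I : Type) (r : seq I) (F : I -> torus R n -> R) :
  (forall i, trigonometric (F i)) -> trigonometric (fun z => \sum_(i <- r) F i z).
Proof.
move=> tF; elim: r => [|i r IH].
  by under eq_fun do rewrite big_nil; exact: trigonometric_cst.
by under eq_fun do rewrite big_cons; exact: trigonometricD.
Qed.

Lemma trigonometric_prod (I : Type) (r : seq I) (F : I -> torus R n -> R) :
  (forall i, trigonometric (F i)) -> trigonometric (fun z => \prod_(i <- r) F i z).
Proof.
move=> tF; elim: r => [|i r IH].
  by under eq_fun do rewrite big_nil; exact: trigonometric_cst.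
by under eq_fun do rewrite big_cons; exact: trigonometricM.
Qed.

Lemma trigonometric_horner (p : {poly R}) F : trigonometric F ->
  trigonometric (fun z => p.[F z]).
Proof.
move=> tF; elim/poly_ind: p => [|p c IH].
  by under eq_fun do rewrite horner0; exact: trigonometric_cst.
under eq_fun do rewrite hornerMXaddC.
by apply: trigonometricD; [exact: trigonometricM|exact: trigonometric_cst].
Qed.

(** |P|^2 is the product of P and its conjugate, and the conjugate of a character
    is a character.  This is why squares of moduli are used throughout. *)
Lemma trigonometric_normc_sqr (P : laurent R n) :
  trigonometric (fun z => normc (laurent_eval P z) ^+ 2).
Proof.
by eexists => z; rewrite normc_sqr laurent_evalE exp_sum_conj exp_sum_mul.
Qed.

Lemma trigonometric_integrable m (A : 'M[int]_(n, m)) F : trigonometric F ->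
  (haar m).-integrable setT (fun z => (F (monomial_map A z))%:E).
Proof.
move=> [t Ft]; rewrite (_ : (fun z => _) = fun z => (complex.Re (exp_sum (subst_terms A t) z))%:E).
  exact: integrable_Re_exp_sum.
by apply/funext => z; rewrite -exp_sum_monomial_map -Ft.
Qed.

(** Only the terms with exponent 0 contribute to either integral, and for large
    height the same terms have exponent 0 before and after the substitution. *)
Lemma trigonometric_integral F : trigonometric F -> exists B : R,
  forall m (A : 'M[int]_(n, m)), (B%:E <= boyd_height A)%E ->
  (\int[haar m]_z F (monomial_map A z) = \int[haar n]_z F z)%R.
Proof.
move=> [t Ft]; have [B HB] := @large_height_neq0 R n [seq x.2 | x <- t].
exists B => m A BA.
have -> : (\int[haar m]_z F (monomial_map A z) =
    \int[haar m]_z complex.Re (exp_sum (subst_terms A t) z))%R.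
  by apply: eq_Rintegral => z _; rewrite -exp_sum_monomial_map -Ft.
have -> : (\int[haar n]_z F z = \int[haar n]_z complex.Re (exp_sum t z))%R.
  by apply: eq_Rintegral => z _; rewrite -Ft.
rewrite !Rintegral_exp_sum big_map /=; congr (complex.Re _).
rewrite big_seq_cond [RHS]big_seq_cond; apply: eq_bigl => x /=.
have [xt|//] := boolP (x \in t).
have [x0|x0] := eqVneq x.2 0; first by rewrite x0 mul0mx eqxx.
by apply/negbTE/(HB _ A BA) => //; exact: map_f.
Qed.

End trigonometric_polynomials.

(** * Limits of approximable functions *)

Section approximation.
Context {R : realType}.

(** Integrability of [f] comes for free from that of [g] and [h]. *)
Lemma Rintegral_close d (T : measurableType d) (mu : probability T R)
    (f g h : T -> R) (eps K : R) : 0 <= eps ->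
  measurable_fun setT f -> mu.-integrable setT (EFin \o g) ->
  measurable_fun setT h -> (forall x, 0 <= h x) ->
  (\int[mu]_x (h x)%:E <= K%:E)%E ->
  {ae mu, forall x, `|f x - g x| <= eps * h x} ->
  mu.-integrable setT (EFin \o f) /\
  `|\int[mu]_x f x - \int[mu]_x g x|%R <= eps * K.
Proof.
move=> eps0 mf ig mh h0 hK fgh.
have mg : measurable_fun setT g by apply/measurable_EFinP; exact: measurable_int ig.
have md : measurable_fun setT (fun x => f x - g x) by exact: measurable_funB.
have dK : (\int[mu]_x `|(f x - g x)%:E| <= (eps * K)%:E)%E.
  apply: le_trans (_ : \int[mu]_x (eps%:E * (h x)%:E) <= _)%E.
    apply: ae_ge0_le_integral => //.
    - by apply: measurableT_comp => //; exact/measurable_EFinP.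
    - by move=> x _; rewrite mule_ge0// lee_fin.
    - by apply: measurable_funeM; exact/measurable_EFinP.
    - by apply: filterS fgh => x xh _; rewrite -EFinM lee_fin.
  rewrite ge0_integralZl//; [|exact/measurable_EFinP|by move=> x _; rewrite lee_fin].
  by rewrite EFinM lee_wpmul2l.
have id : mu.-integrable setT (EFin \o (fun x => f x - g x)).
  apply/integrableP; split; first exact/measurable_EFinP.
  exact: le_lt_trans dK (ltry _).
have if_ : mu.-integrable setT (EFin \o f).
  have := integrableD measurableT id ig; apply: eq_integrable => // x _ /=.
  by rewrite -EFinD subrK.
split=> //; rewrite -RintegralB// -lee_fin.
rewrite EFin_normr_Rintegral//; apply: le_trans dK.
by apply: le_abse_integral => //; exact/measurable_EFinP.
Qed.

Lemma common_bound k (Q : 'I_k -> R -> Prop) :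
  (forall i b c, b <= c -> Q i b -> Q i c) -> (forall i, exists b, Q i b) ->
  exists b, forall i, Q i b.
Proof.
move=> Qle /choice[b Qb]; exists (\sum_i `|b i|) => i.
apply: Qle (Qb i); rewrite (bigD1 i)//=; apply: le_trans (ler_norm _) _.
by rewrite lerDl sumr_ge0.
Qed.

(** The dominating sum of powers of the [c + abs_log (P i)] has integrals bounded
    by some [K] for all [A] of large height.  Hence the integrals of [G] and of its
    approximation [F] differ by at most [eps * K], both on the source torus and,
    taking the identity matrix for [A], on the target, while the two integrals of
    [F] are equal. *)
Lemma approximation_limit n k (P : 'I_k -> laurent R n) (g : pfun R n)
    (G : torus R n -> R) (c : R) (q : nat) :
  (forall i, P i != [fsfun]) -> 0 <= c -> measurable_fun setT G ->
  (forall z, (forall i, laurent_eval (P i) z != 0) -> g z = Some (G z)%:C) ->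
  (forall eps, 0 < eps -> exists2 F, trigonometric F &
     forall z, (forall i, laurent_eval (P i) z != 0) ->
       `|G z - F z| <= eps * \sum_i (c + abs_log (P i) z) ^+ q) ->
  exists I, has_integral g I /\
    forall eps : R, 0 < eps -> exists M : R, forall m (A : 'M[int]_(n, m)),
      (M%:E <= boyd_height A)%E ->
      exists J, has_integral (g \o monomial_map A) J /\ normc (I - J) < eps.
Proof.
move=> P0 c0 mG gG GF.
pose H z := \sum_i (c + abs_log (P i) z) ^+ q.
have l0 i z : 0 <= (c + abs_log (P i) z) ^+ q.
  by rewrite exprn_ge0// addr_ge0//; exact: normr_ge0.
have H0 z : 0 <= H z by rewrite sumr_ge0.
have mlog m (A : 'M[int]_(n, m)) i :
    measurable_fun setT (fun z : torus R m => abs_log (P i) (monomial_map A z)).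
  have mln := measurableT_comp (@measurable_ln R) (measurable_laurent A (P i)).
  exact: (measurableT_comp (@normr_measurable R setT) mln).
have mterm m (A : 'M[int]_(n, m)) i :
    measurable_fun setT (fun z : torus R m => (c + abs_log (P i) (monomial_map A z)) ^+ q).
  apply: measurable_funX; apply: measurable_funD; [exact: measurable_cst|exact: mlog].
have mH m (A : 'M[int]_(n, m)) : measurable_fun setT (fun z : torus R m => H (monomial_map A z)).
  by apply: measurable_sum => i; exact: mterm.
pose Q (i : 'I_k) (B : R) :=
    (forall m (A : 'M[int]_(n, m)), (B%:E <= boyd_height A)%E ->
       (haar m).-negligible [set z | laurent_eval (P i) (monomial_map A z) = 0]) /\
    (exists2 K : R, 0 <= K & forall m (A : 'M[int]_(n, m)), (B%:E <= boyd_height A)%E ->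
       (\int[haar m]_z ((c + abs_log (P i) (monomial_map A z)) ^+ q)%:E <= K%:E)%E).
have [B HB] : exists B, forall i, Q i B.
  apply: common_bound => [i b b' bb' [neg [K K0 HK]]|i].
    have le m (A : 'M[int]_(n, m)) : (b'%:E <= boyd_height A)%E -> (b%:E <= boyd_height A)%E.
      by apply: le_trans; rewrite lee_fin.
    by split=> [m A /le|]; [exact: neg|exists K => // m A /le; exact: HK].
  have [b [neg mom]] := log_moment (P0 i).
  by exists b; split => //; exact: mom.
have [K HK] : exists K : R, forall m (A : 'M[int]_(n, m)), (B%:E <= boyd_height A)%E ->
    (\int[haar m]_z (H (monomial_map A z))%:E <= K%:E)%E.
  have /choice[K_ HK] : forall i, exists K : R, forall m (A : 'M[int]_(n, m)),
      (B%:E <= boyd_height A)%E ->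
      (\int[haar m]_z ((c + abs_log (P i) (monomial_map A z)) ^+ q)%:E <= K%:E)%E.
    by move=> i; have [_ [K _ HK]] := HB i; exists K.
  exists (\sum_i K_ i) => m A BA.
  under eq_integral do rewrite /H -sumEFin.
  rewrite ge0_integral_sum//; last 2 first.
  - by move=> i; apply/measurable_EFinP; exact: mterm.
  - by move=> i z _; rewrite lee_fin.
  by rewrite -sumEFin; apply: lee_sum => i _; exact: HK.
have ae_neq0 m (A : 'M[int]_(n, m)) : (B%:E <= boyd_height A)%E ->
    {ae haar m, forall z, forall i, laurent_eval (P i) (monomial_map A z) != 0}.
  move=> BA; apply: filter_forall => i.
  have := (HB i).1 m A BA; apply: negligibleS => z /=.
  by move=> /negP; rewrite negbK => /eqP.
have close eps F m (A : 'M[int]_(n, m)) : 0 < eps -> trigonometric F ->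
    (forall z, (forall i, laurent_eval (P i) z != 0) -> `|G z - F z| <= eps * H z) ->
    (B%:E <= boyd_height A)%E ->
    (haar m).-integrable setT (fun z => (G (monomial_map A z))%:E) /\
    `|\int[haar m]_z G (monomial_map A z) - \int[haar m]_z F (monomial_map A z)|%R
      <= eps * K.
  move=> eps0 tF FG BA.
  apply: (@Rintegral_close _ _ (haar m) _ _ (fun z => H (monomial_map A z))).
  - exact: ltW.
  - exact: (measurableT_comp mG (measurable_monomial_map A)).
  - exact: trigonometric_integrable.
  - exact: mH.
  - by move=> z; exact: H0.
  - exact: HK.
  - by apply: filterS (ae_neq0 _ _ BA) => z; exact: FG.
have hasint m (A : 'M[int]_(n, m)) : (B%:E <= boyd_height A)%E ->
    has_integral (g \o monomial_map A) ((\int[haar m]_z G (monomial_map A z))%R)%:C.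
  move=> BA; exists (fun z => (G (monomial_map A z))%:C); split.
  - by apply: filterS (ae_neq0 _ _ BA) => z; exact: gG.
  - have [F tF FG] := GF 1 ltr01.
    by split; [have [] := close _ _ _ _ ltr01 tF FG BA|exact: integrable0].
  - rewrite /cintegral /=; congr (_ +i* _).
    by rewrite Rintegral_cst// mul0r.
have ht1 : (B%:E <= boyd_height (1%:M : 'M[int]_n))%E by rewrite boyd_height1 leey.
have id1 : monomial_map 1%:M = id :> (torus R n -> torus R n).
  by apply/funext => z; exact: monomial_map1.
exists ((\int[haar n]_z G z)%R)%:C; split.
  by have := hasint n 1%:M ht1; rewrite id1.
move=> eps eps0.
pose e := eps / (4 * (`|K| + 1)).
have K0 : 0 < `|K| + 1 by rewrite ltr_wpDl.
have e0 : 0 < e by rewrite divr_gt0// mulr_gt0.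
have [F tF FG] := GF e e0.
have [B' HB'] := trigonometric_integral tF.
exists (Num.max B B') => m A; rewrite EFin_max ge_max => /andP[BA B'A].
exists ((\int[haar m]_z G (monomial_map A z))%R)%:C; split; first exact: hasint.
rewrite -rmorphB normc_real.
have [_ c1] := close _ _ _ _ e0 tF FG ht1.
have [_ c2] := close _ _ _ _ e0 tF FG BA.
rewrite HB'// in c2; move: c1; rewrite id1 /= => c1.
have eK : e * K <= eps / 4.
  rewrite /e invfM mulrA -mulrA ler_piMr ?divr_ge0 ?(ltW eps0)// mulrC ler_pdivrMr// mul1r.
  by apply: le_trans (ler_norm _) _; rewrite lerDl.
set I := (X in `|X - _|); set J := (X in `|_ - X|).
rewrite -[I - J](subrKA (\int[haar n]_z F z)%R) -/I -/J.
apply: le_lt_trans (ler_normD _ _) _; rewrite [X in _ + X]distrC.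
apply: le_lt_trans (lerD (le_trans c1 eK) (le_trans c2 eK)) _; lra.
Qed.

End approximation.

(** * Products of logarithms *)

Section products.
Context {R : realType}.

(** Telescoping; as all [t i >= 1], the partial products of the [a i] and of the
    [b i] are bounded by the product of the [t i ^+ 2]. *)
Lemma prod_close (I : Type) (r : seq I) (a b t : I -> R) (e : R) : 0 <= e ->
  (forall i, 1 <= t i) -> (forall i, `|a i| <= t i) -> (forall i, `|b i| <= t i) ->
  (forall i, `|a i - b i| <= e * t i ^+ 2) ->
  `|\prod_(i <- r) a i - \prod_(i <- r) b i| <=
    (size r)%:R * e * \prod_(i <- r) t i ^+ 2.
Proof.
move=> e0 t1 at_ bt abt; have t0 i : 0 <= t i by exact: le_trans ler01 (t1 i).
elim: r => [|i r IH]; first by rewrite !big_nil subrr normr0 mul0r mul0r.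
rewrite !big_cons /=.
set A := \prod_(j <- r) a j in IH *; set B := \prod_(j <- r) b j in IH *.
set T := \prod_(j <- r) t j ^+ 2 in IH *.
have BT : `|B| <= T.
  rewrite normr_prod; apply: ler_prod => j _; rewrite normr_ge0 /=.
  by apply: le_trans (bt j) _; rewrite expr2 ler_peMr.
have T0 : 0 <= T by exact: le_trans (normr_ge0 _) BT.
rewrite (_ : a i * A - b i * B = a i * (A - B) + (a i - b i) * B); last by ring.
apply: le_trans (ler_normD _ _) _; rewrite !normrM.
have h1 : `|a i| * `|A - B| <= t i ^+ 2 * ((size r)%:R * e * T).
  apply: ler_pM => //; apply: le_trans (at_ i) _.
  by rewrite expr2 ler_peMr.
have h2 : `|a i - b i| * `|B| <= e * t i ^+ 2 * T by exact: ler_pM.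
apply: le_trans (lerD h1 h2) _; rewrite -natr1.
by rewrite le_eqVlt; apply/orP; left; apply/eqP; ring.
Qed.

(** Compare each factor with the largest one. *)
Lemma prod_le_sum_pow k (y : 'I_k -> R) : (0 < k)%N -> (forall i, 0 <= y i) ->
  \prod_i y i <= \sum_i y i ^+ k.
Proof.
move=> k0 y0; pose i1 := Ordinal k0.
have [i0 _ imax] := @Order.TotalTheory.arg_maxP _ _ _ i1 xpredT y isT.
apply: le_trans (_ : y i0 ^+ k <= _); last first.
  by rewrite (bigD1 i0)//= lerDl sumr_ge0// => i _; rewrite exprn_ge0.
rewrite -[in leRHS](card_ord k) -prodr_const; apply: ler_prod => i _.
by rewrite y0; exact: imax.
Qed.

(** Each factor ln|P_i| = ln M + (ln x_i)/2, with x_i = |P_i|^2 / M^2, is replaced by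
    ln M + p(x_i)/2.  The error is dominated by eps times a product of powers of the
    c + |ln|P_i||, which are not independent; [prod_le_sum_pow] bounds it by moments of single
    logarithms. *)
Lemma prod_log_approx n k (P : 'I_k -> laurent R n) : (0 < k)%N ->
  exists2 c : R, 0 <= c & forall eps, 0 < eps -> exists2 F : torus R n -> R,
    trigonometric F & forall z, (forall i, laurent_eval (P i) z != 0) ->
      `|\prod_i ln (normc (laurent_eval (P i) z)) - F z| <=
        eps * \sum_i (c + abs_log (P i) z) ^+ (2 * k).
Proof.
move=> k0; have [M M0 PM] := laurent_bound P.
exists (1 + 2 * `|ln M|); first by rewrite addr_ge0// mulr_ge0.
move=> eps eps0.
have k0' : 0 < k%:R :> R by rewrite ltr0n.
pose e := eps / (2 * k%:R); have e0 : 0 < e by rewrite divr_gt0// mulr_gt0.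
have [p Hp] := log_poly_approx e0.
exists (fun z => \prod_i (ln M + 2^-1 *
    p.[normc (laurent_eval (P i) z) ^+ 2 / M ^+ 2])).
  apply: trigonometric_prod => i; apply: trigonometricD; first exact: trigonometric_cst.
  apply: trigonometricM; first exact: trigonometric_cst.
  apply: trigonometric_horner; apply: trigonometricM; last exact: trigonometric_cst.
  exact: trigonometric_normc_sqr.
move=> z Pz; pose t i := 1 + 2 * `|ln M| + abs_log (P i) z.
have l0 i : 0 <= abs_log (P i) z by exact: normr_ge0.
have lM0 : 0 <= `|ln M| by exact: normr_ge0.
have t1 i : 1 <= t i by rewrite /t; move: (l0 i); lra.
have fact i : [/\ `|ln (normc (laurent_eval (P i) z))| <= t i,
   `|ln M + 2^-1 * p.[normc (laurent_eval (P i) z) ^+ 2 / M ^+ 2]| <= t i &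
   `|ln (normc (laurent_eval (P i) z)) -
      (ln M + 2^-1 * p.[normc (laurent_eval (P i) z) ^+ 2 / M ^+ 2])| <=
     2 * e * t i ^+ 2].
  have [x01 lE lx] := ln_normalized (normc_gt0 (Pz i)) (PM i z).
  have [px ex] := Hp _ x01.
  set f := normc _ in x01 lE lx px ex *; set x := f ^+ 2 / M ^+ 2 in x01 lE lx px ex *.
  have tE : t i = 1 + 2 * `|ln M| + `|ln f| by [].
  split.
  - by rewrite tE; lra.
  - apply: le_trans (ler_normD _ _) _; rewrite normrM ger0_norm ?invr_ge0//.
    by rewrite tE; lra.
  - rewrite {1}lE opprD addrACA subrr add0r -mulrBr normrM ger0_norm ?invr_ge0//.
    have : (1 + `|ln x|) ^+ 2 <= (2 * t i) ^+ 2.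
      apply: lerXn2r; rewrite ?nnegrE ?addr_ge0 ?mulr_ge0//; first exact: le_trans ler01 (t1 i).
      by rewrite tE; lra.
    move=> /(ler_wpM2l (ltW e0)); rewrite exprMn; move: ex.
    move: (`|ln x - p.[x]|) ((1 + `|ln x|) ^+ 2) (t i ^+ 2) => u v w; lra.
have e20 : 0 <= 2 * e by rewrite mulr_ge0// ltW.
apply: le_trans (@prod_close _ (index_enum 'I_k) _ _ t (2 * e) e20 t1 _ _ _) _.
- by move=> i; have [] := fact i.
- by move=> i; have [] := fact i.
- by move=> i; have [] := fact i.
have -> : (size (index_enum 'I_k))%:R * (2 * e) = eps.
  rewrite -[index_enum _]/(Finite.enum _) -enumT size_enum_ord /e; field.
  exact: lt0r_neq0.
rewrite ler_pM2l//.
apply: le_trans (prod_le_sum_pow k0 _) _; first by move=> i; rewrite exprn_ge0// (le_trans ler01).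
by under eq_bigr do rewrite -exprM.
Qed.

End products.

(** * Maxima of logarithms *)

Section maxima.
Context {R : realType}.

(** Expresses the extended-real maximum through a real-valued one, whose
    measurability is immediate. *)
Lemma max_logE n k (P : 'I_k -> laurent R n) z : (0 < k)%N ->
  (forall i, laurent_eval (P i) z != 0) ->
  exists i0, [/\ forall i, normc (laurent_eval (P i) z) <= normc (laurent_eval (P i0) z),
    \big[Num.max/0]_i normc (laurent_eval (P i) z) = normc (laurent_eval (P i0) z) &
    max_log P z = Some (ln (normc (laurent_eval (P i0) z)))%:C].
Proof.
move=> k0 Pz; pose f i := normc (laurent_eval (P i) z).
have f0 i : 0 < f i by exact: normc_gt0.
have [i0 _ imax] := @Order.TotalTheory.arg_maxP _ _ _ (Ordinal k0) xpredT f isT.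
exists i0; split; first by move=> i; exact: imax.
  apply/eqP; rewrite eq_le; apply/andP; split; last exact: (le_bigmax _ f).
  by apply: bigmax_le => [|i _]; [exact: normc_ge0|exact: imax].
rewrite /max_log ifF; last first.
  by apply/negbTE; rewrite negb_forall; apply/existsP; exists i0.
rewrite (_ : \big[maxe/-oo%E]_(i < k) _ = (ln (f i0))%:E)//.
apply/eqP; rewrite eq_le; apply/andP; split.
  apply: bigmax_le => [|i _]; first exact: leNye.
  rewrite -/(f i) lne_EFin//.
  by have : ((ln (f i))%:E <= (ln (f i0))%:E)%E by rewrite lee_fin ler_ln ?posrE//; exact: imax.
rewrite -lne_EFin//.
exact: (le_bigmax _ (fun i => lne (f i)%:E)).
Qed.

(** The sum of the N-th powers lies between its largest term and k times it. *)
Lemma power_mean_bounds k (x : 'I_k -> R) i0 N : (forall i, 0 < x i) ->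
  (forall i, x i <= x i0) ->
  N%:R * ln (x i0) - ln k%:R <= ln (k%:R^-1 * \sum_i x i ^+ N) <= N%:R * ln (x i0).
Proof.
move=> x0 xmax.
have k0 : 0 < k%:R :> R by case: k i0 {x x0 xmax} => [[]|k _]//; rewrite ltr0n.
have p0 : 0 < x i0 ^+ N by rewrite exprn_gt0.
have low : k%:R^-1 * x i0 ^+ N <= k%:R^-1 * \sum_i x i ^+ N.
  rewrite ler_pM2l ?invr_gt0// (bigD1 i0)//= lerDl sumr_ge0// => i _.
  by rewrite exprn_ge0// ltW.
have high : k%:R^-1 * \sum_i x i ^+ N <= x i0 ^+ N.
  rewrite ler_pdivrMl// mulr_natl -[X in _ *+ X]card_ord -sumr_const.
  apply: ler_sum => i _; apply: lerXn2r; rewrite ?nnegrE; [exact: ltW|exact: ltW|].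
  exact: xmax.
have l0 : 0 < k%:R^-1 * x i0 ^+ N by rewrite mulr_gt0// invr_gt0.
have NE : N%:R * ln (x i0) = ln (x i0 ^+ N) by rewrite lnXn// mulr_natl.
rewrite NE; apply/andP; split; last by rewrite ler_ln ?posrE// (lt_le_trans l0).
rewrite addrC -lnV ?posrE// -lnM ?posrE ?invr_gt0//.
by rewrite ler_ln ?posrE// (lt_le_trans l0).
Qed.

(** The maximum of the ln x_i, with x_i = |P_i|^2 / M^2, is within (ln k)/N of
    (ln y)/N, where y is the mean of the x_i^N; and y is a trigonometric polynomial
    with values in ]0, 1], so that ln y can be replaced by p(y).  As
    |ln y| <= N |ln x_i| + ln k for the largest x_i, the error is controlled by the
    moments of a single logarithm. *)
Lemma max_log_approx n k (P : 'I_k -> laurent R n) : (0 < k)%N ->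
  exists2 c : R, 0 <= c & forall eps, 0 < eps -> exists2 F : torus R n -> R,
    trigonometric F & forall z, (forall i, laurent_eval (P i) z != 0) ->
      `|ln (\big[Num.max/0]_i normc (laurent_eval (P i) z)) - F z| <=
        eps * \sum_i (c + abs_log (P i) z) ^+ 2.
Proof.
move=> k0; have [M M0 PM] := laurent_bound P.
have k1 : 0 < k%:R :> R by rewrite ltr0n.
have lk : 0 <= ln k%:R :> R by rewrite ln_ge0// ler1n.
have lM0 : 0 <= `|ln M| by exact: normr_ge0.
exists (1 + `|ln M| + ln k%:R); first by rewrite !addr_ge0.
move=> eps eps0.
(* N makes the error (ln k)/(2N) of the power mean at most eps/2, and e then makes
   the error of the polynomial approximation at most eps/2. *)
pose N := (Num.truncn (ln k%:R / eps)).+1.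
have NE : ln k%:R <= N%:R * eps.
  rewrite -ler_pdivrMr//; apply/ltW.
  by have /andP[] : (_ <= _ < _) := truncn_itv (divr_ge0 lk (ltW eps0)).
have N1 : 1 <= N%:R :> R by rewrite ler1n.
have N0 : 0 < N%:R :> R by rewrite ltr0n.
pose e := eps / (4 * N%:R); have e0 : 0 < e by rewrite divr_gt0// mulr_gt0.
have [p Hp] := log_poly_approx e0.
pose y z := k%:R^-1 * \sum_i (normc (laurent_eval (P i) z) ^+ 2 / M ^+ 2) ^+ N.
exists (fun z => ln M + (2 * N%:R)^-1 * p.[y z]).
  apply: trigonometricD; first exact: trigonometric_cst.
  apply: trigonometricM; first exact: trigonometric_cst.
  apply: trigonometric_horner; apply: trigonometricM; first exact: trigonometric_cst.
  apply: trigonometric_sum => i.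
  have tx : trigonometric (fun z => normc (laurent_eval (P i) z) ^+ 2 / M ^+ 2).
    by apply: trigonometricM; [exact: trigonometric_normc_sqr|exact: trigonometric_cst].
  have := trigonometric_horner 'X^N tx.
  by under eq_fun do rewrite hornerXn.
move=> z Pz; have [i0 [imax -> _]] := max_logE k0 Pz.
have ax i := ln_normalized (normc_gt0 (Pz i)) (PM i z).
pose x i := normc (laurent_eval (P i) z) ^+ 2 / M ^+ 2.
have x0 i : 0 < x i by have [/andP[]] := ax i.
have xi0 i : x i <= x i0.
  by rewrite ler_pM2r ?invr_gt0 ?exprn_gt0// ler_pXn2r// nnegrE normc_ge0.
have [/andP[_ x1] lE lx] := ax i0.
rewrite -/(x i0) in x1 lE lx.
have lx0 : ln (x i0) <= 0 by exact: ln_le0.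
have y01 : 0 < y z <= 1.
  apply/andP; split.
    apply: mulr_gt0; first by rewrite invr_gt0.
    rewrite (bigD1 i0)//=; apply: ltr_pwDl; first exact: exprn_gt0 (x0 i0).
    by apply: sumr_ge0 => i _; rewrite exprn_ge0// ltW// x0.
  rewrite ler_pdivrMl// mulr1 -[X in _ <= X%:R]card_ord -sumr_const.
  by apply: ler_sum => i _; apply: exprn_ile1; [exact: ltW (x0 i)|exact: le_trans (xi0 i) x1].
have /andP[yl yu] := power_mean_bounds N x0 xi0.
rewrite -/(y z) in yl yu.
have [_ ey] := Hp _ y01.
have ly0 : ln (y z) <= 0 by apply: ln_le0; case/andP: y01.
set f := normc _ in lE lx; set L := ln (y z) in yl yu ey ly0.
pose t := 1 + `|ln M| + ln k%:R + `|ln f|.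
have t1 : 1 <= t by rewrite /t; move: (normr_ge0 (ln f)); lra.
apply: le_trans (_ : eps * t ^+ 2 <= _); last first.
  rewrite ler_pM2l// (bigD1 i0)//= lerDl sumr_ge0// => i _.
  exact: sqr_ge0.
have tL : 1 + `|L| <= 2 * N%:R * t.
  rewrite (ler0_norm lx0) in lx; rewrite (ler0_norm ly0).
  have h1 : - L <= N%:R * (2 * `|ln f| + 2 * `|ln M|) + ln k%:R.
    apply: le_trans (_ : N%:R * - ln (x i0) + ln k%:R <= _); first by move: yl; lra.
    by rewrite lerD2r ler_pM2l.
  have h2 : 1 <= N%:R * (1 : R) by rewrite mulr1.
  have h3 : ln k%:R <= N%:R * ln k%:R :> R by rewrite ler_peMl.
  have h4 : 0 <= N%:R * (1 : R) by rewrite mulr1 ltW.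
  have h5 : 0 <= N%:R * ln k%:R :> R by rewrite mulr_ge0// ltW.
  rewrite /t; move: h1 h2 h3 h4 h5.
  move: (N%:R : R) (ln k%:R : R) (`|ln f|) (`|ln M|) (- L); clear => n l a b L; lra.
have tL2 : (1 + `|L|) ^+ 2 <= (2 * N%:R * t) ^+ 2.
  apply: lerXn2r => //; rewrite nnegrE ?addr_ge0//.
  by rewrite !mulr_ge0// ?(ltW N0) ?(le_trans ler01 t1).
have eE : e * (2 * N%:R * t) ^+ 2 = eps * N%:R * t ^+ 2.
  by rewrite /e; field; exact: lt0r_neq0.
have epy : `|L - p.[y z]| <= eps * N%:R * t ^+ 2.
  by apply: le_trans ey _; rewrite -eE ler_pM2l.
rewrite lE (_ : _ - _ = (2 * N%:R)^-1 * ((N%:R * ln (x i0) - L) + (L - p.[y z]))); last first.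
  by field; exact: lt0r_neq0.
rewrite normrM gtr0_norm ?invr_gt0 ?mulr_gt0// ler_pdivrMl ?mulr_gt0//.
apply: le_trans (ler_normD _ _) _.
have h1 : `|N%:R * ln (x i0) - L| <= N%:R * eps.
  rewrite ger0_norm ?subr_ge0//; apply: le_trans NE; move: yl; lra.
have h2 : N%:R * eps <= eps * N%:R * t ^+ 2.
  rewrite [N%:R * eps]mulrC; apply: ler_peMr; last exact: exprn_ege1.
  by apply: mulr_ge0; exact: ltW.
apply: le_trans (lerD (le_trans h1 h2) epy) _.
by rewrite le_eqVlt; apply/orP; left; apply/eqP; ring.
Qed.

End maxima.

(** * Monomial substitutions in Laurent polynomials *)

Section composition.
Context {R : realType}.

(** Monomials whose exponents have the same image under [A] are merged. *)
Definition laurent_comp n m (P : laurent R n) (A : 'M[int]_(n, m)) : laurent R m :=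
  [fsfun e in [fset f *m A | f in finsupp P]%fset =>
     \sum_(f <- finsupp P | f *m A == e) P f].

Lemma laurent_compE n m (P : laurent R n) (A : 'M[int]_(n, m)) e :
  laurent_comp P A e = \sum_(f <- finsupp P | f *m A == e) P f.
Proof.
rewrite fsfunE; case: ifPn => // eA.
rewrite big_seq_cond big1// => f /andP[fP /eqP fA].
by case/negP: eA; apply/imfsetP; exists f.
Qed.

Lemma laurent_eval_comp n m (P : laurent R n) (A : 'M[int]_(n, m)) z :
  laurent_eval (laurent_comp P A) z = laurent_eval P (monomial_map A z).
Proof.
transitivity (\sum_(e <- [fset f *m A | f in finsupp P]%fset)
    laurent_comp P A e * chi e z).
  apply: big_fset_incl => [|e _ eQ].
    apply/fsubsetP => e; rewrite mem_finsupp fsfunE.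
    by case: ifP => //; rewrite eqxx.
  by rewrite fsfun_dflt// mul0r.
under eq_bigr do rewrite laurent_compE mulr_suml.
rewrite (exchange_big_dep xpredT)//=; apply: eq_big_seq => f fP.
rewrite big_mkcond (bigD1_seq (f *m A)) ?fset_uniq//=; last by apply/imfsetP; exists f.
rewrite eqxx big1 => [|e /negbTE fe]; last by rewrite eq_sym fe.
by rewrite addr0 -chi_monomial_map.
Qed.

(** Fix an exponent [e0] of [P].  For [A] of large height, no other exponent of [P]
    has the same image as [e0] under [A], so that the coefficient of [e0] survives. *)
Lemma laurent_comp_neq0 n (P : laurent R n) : P != [fsfun] ->
  exists B : R, forall m (A : 'M[int]_(n, m)), (B%:E <= boyd_height A)%E ->
    laurent_comp P A != [fsfun].
Proof.
move=> P0; have [e0 Pe0 _] := laurent_head P0.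
have [B HB] := @large_height_neq0 R n [seq e - e0 | e <- finsupp P].
exists B => m A BA; apply/eqP => Q0.
have : laurent_comp P A (e0 *m A) = 0 by rewrite Q0 fsfun0E.
rewrite laurent_compE big_mkcond (bigD1_seq e0) ?fset_uniq ?mem_finsupp//= eqxx.
rewrite big_seq_cond big1 ?addr0 => [/eqP|e /andP[eP ee0]]; first exact/negP.
rewrite -subr_eq0 -mulmxBl ifN//; apply: (HB _ A BA); last by rewrite subr_eq0.
by apply/mapP; exists e.
Qed.

Lemma max_log_comp n m k (P : 'I_k -> laurent R n) (A : 'M[int]_(n, m)) :
  max_log P \o monomial_map A = max_log (fun i => laurent_comp (P i) A).
Proof.
apply/funext => z; rewrite /max_log /=.
under [in RHS]eq_forallb do rewrite laurent_eval_comp.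
by under [in RHS]eq_bigr do rewrite laurent_eval_comp.
Qed.

Lemma prod_log_comp n m k (P : 'I_k -> laurent R n) (A : 'M[int]_(n, m)) :
  prod_log P \o monomial_map A = prod_log (fun i => laurent_comp (P i) A).
Proof.
apply/funext => z; rewrite /prod_log /=.
under [in RHS]eq_existsb do rewrite laurent_eval_comp.
by under [in RHS]eq_bigr do rewrite laurent_eval_comp.
Qed.

Lemma laurents_comp_neq0 n k (P : 'I_k -> laurent R n) : (forall i, P i != [fsfun]) ->
  exists B : R, forall m (A : 'M[int]_(n, m)), (B%:E <= boyd_height A)%E ->
    forall i, laurent_comp (P i) A != [fsfun].
Proof.
move=> P0; pose Q (i : 'I_k) (B : R) := forall m (A : 'M[int]_(n, m)),
  (B%:E <= boyd_height A)%E -> laurent_comp (P i) A != [fsfun].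
have [B HB] : exists B, forall i, Q i B.
  apply: common_bound => [i b c bc Qb m A cA|i]; last exact: laurent_comp_neq0.
  by apply: Qb; apply: le_trans cA; rewrite lee_fin.
by exists B => m A BA i; exact: HB.
Qed.

End composition.

(** * The two collections *)

Section limits.
Context {R : realType}.

(** The limit over all the homomorphisms into the n-torus; the definition of a
    Boyd-Lawton collection only involves those from the circle. *)
Definition boyd_lawton_limit_at n (g : pfun R n) := exists I, has_integral g I /\
  forall eps : R, 0 < eps -> exists M : R, forall m (A : 'M[int]_(n, m)),
    (M%:E <= boyd_height A)%E ->
    exists J, has_integral (g \o monomial_map A) J /\ normc (I - J) < eps.

Lemma boyd_lawton_of_limits (C : forall n, set (pfun R n)) :
  (forall n g, C n g -> boyd_lawton_limit_at g) ->
  (forall n g, C n g -> exists B : R, forall m (A : 'M[int]_(n, m)),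
    (B%:E <= boyd_height A)%E -> C m (g \o monomial_map A)) ->
  boyd_lawton C.
Proof.
move=> lim comp; split => n g _ Cg.
- by have [_ [[h [gh ih _]] _]] := lim n g Cg; exists h.
- have [I [gI HI]] := lim n g Cg; exists I; split=> // eps /HI[M HM].
  by exists M => r; exact: HM.
- by have [B HB] := comp n g Cg; exists B => m A _; exact: HB.
Qed.

Lemma prod_log_limit n (g : pfun R n) : prod_log_collection g -> boyd_lawton_limit_at g.
Proof.
move=> [k [P [k0 P0 ->]]]; have [c c0 approx] := prod_log_approx P k0.
apply: (approximation_limit P0 c0 _ _ approx).
- apply: measurable_prod => i _.
  exact: (measurableT_comp (@measurable_ln R) (measurable_normc_laurent (P i))).
- move=> z Pz; rewrite /prod_log ifF//; apply/negbTE; rewrite negb_exists.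
  exact/forallP.
Qed.

Lemma max_log_limit n (g : pfun R n) : max_log_collection g -> boyd_lawton_limit_at g.
Proof.
move=> [k [P [k0 P0 ->]]]; have [c c0 approx] := max_log_approx P k0.
apply: (approximation_limit P0 c0 _ _ approx).
- have mmax (r : seq 'I_k) : measurable_fun setT (fun z : torus R n =>
      \big[Num.max/0]_(i <- r) normc (laurent_eval (P i) z)).
    elim: r => [|i r IH]; first by under eq_fun do rewrite big_nil; exact: measurable_cst.
    under eq_fun do rewrite big_cons.
    exact: (measurable_maxr (measurable_normc_laurent (P i)) IH).
  exact: (measurableT_comp (@measurable_ln R) (mmax _)).
- by move=> z Pz; have [i0 [_ -> ->]] := max_logE k0 Pz.
Qed.

End limits.

Theorem proposition4p4 (R : realType) :
  boyd_lawton (@max_log_collection R) /\ boyd_lawton (@prod_log_collection R).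
Proof.
split; apply: boyd_lawton_of_limits.
- exact: max_log_limit.
- move=> n _ [k [P [k0 P0 ->]]]; have [B HB] := laurents_comp_neq0 P0.
  exists B => m A BA; exists k, (fun i => laurent_comp (P i) A).
  by split=> //; [exact: HB|exact: max_log_comp].
- exact: prod_log_limit.
- move=> n _ [k [P [k0 P0 ->]]]; have [B HB] := laurents_comp_neq0 P0.
  exists B => m A BA; exists k, (fun i => laurent_comp (P i) A).
  by split=> //; [exact: HB|exact: prod_log_comp].
Qed.
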